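(* Let $G=\mathrm{U}(n)$ and let $b\in\mathbb{R}^n$, identified with a diagonal matrix. Let $\mu_b$ be the measure on $\mathbb{R}^n$ obtained by projecting to the diagonal the invariant probability measure on the orbit $\{ubu^{-1}:u\in \mathrm{U}(n)\}$. Then $\mu_b$ has the following moments: for every partition $\eta\in\Pi$, $$\int_{\mathbb{R}^n}m_{\eta}(x)\,d\mu_b(x)=\sum_{\lambda\in\Pi}\frac{\delta!\,|S_n\cdot\eta|\,\eta!}{(\lambda+\delta)!}K_{\lambda\eta}\,s_{\lambda}(b),$$ and the moment of the monomial $x^\eta$ is $$\int_{\mathbb{R}^n}x^{\eta}\,d\mu_b(x)=\sum_{\lambda\in\Pi}\frac{\delta!\,\eta!}{(\lambda+\delta)!}K_{\lambda\eta}\,s_{\lambda}(b).$$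
   Context: For $b=(b_1,\dots,b_n)\in\mathbb{R}^n$, identified with $\mathrm{diag}(b_1,\dots,b_n)$, let $\nu_b$ be the unique conjugation-invariant probability measure on the orbit $\{ubu^{-1}:u\in\mathrm{U}(n)\}$ of Hermitian matrices (the pushforward of the Haar probability measure), and let $\mu_b=\mathrm{pr}_*(\nu_b)$, where $\mathrm{pr}$ sends a Hermitian matrix to the vector of its diagonal entries. $\Pi=\{\lambda\in\mathbb{N}_0^n:\lambda_1\ge\lambda_2\ge\dots\ge\lambda_n\}$; for $\mu\in\mathbb{N}_0^n$, $x^\mu=x_1^{\mu_1}\cdots x_n^{\mu_n}$ and $\mu!=\mu_1!\cdots\mu_n!$; $\delta=(n-1,n-2,\dots,0)$. $|S_n\cdot\eta|$ is the number of distinct permutations of $\eta$, and $m_\eta$ is the monomial symmetric polynomial, the sum of $x^\lambda$ over the distinct permutations $\lambda$ of $\eta$. $s_\lambda=a_{\lambda+\delta}/a_\delta$ is the Schur polynomial, with $a_\mu(x_1,\dots,x_n)=\det[x_i^{\mu_j}]_{i,j=1}^n$. $K_{\lambda\eta}$ are the Kostka numbers (number of semistandard Young tableaux of shape $\lambda$ and weight $\eta$), so $s_\lambda=\sum_\eta K_{\lambda\eta}m_\eta$; $K_{\lambda\eta}=0$ unless $\lambda_1+\dots+\lambda_n=\eta_1+\dots+\eta_n$, so the sums are finite. *)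

(* Defs.v *)
From HB Require Import structures.
From mathcomp Require Import all_boot all_order all_algebra all_fingroup.
From mathcomp Require Import all_classical all_reals all_analysis.
From mathcomp Require Import complex.
From mathcomp.multinomials Require mpoly.
(* The notations of mpoly clash with those of mathcomp-analysis. *)
Import -(notations) mpoly.

Set Implicit Arguments.
Unset Strict Implicit.
Unset Printing Implicit Defensive.

Import Order.TTheory GRing.Theory Num.Theory.
Import numFieldNormedType.Exports.
Local Open Scope classical_set_scope.
Local Open Scope ring_scope.

Section Combinatorics.
Variable n : nat.
Implicit Types (lam eta mu : multinom n).

Definition partitions : set (multinom n) :=
  [set lam | forall i j : 'I_n, (i <= j)%N -> (lam j <= lam i)%N].

Definition delta : multinom n := Multinom [tuple (n.-1 - i)%N | i < n].

Definition mfact mu : nat := (\prod_(i < n) (mu i)`!)%N.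

Definition perms eta : seq (multinom n) :=
  undup [seq Multinom [tuple eta (s i) | i < n] | s : {perm 'I_n}].

(* The cells of the Young diagram: (i, j) with j < lam i, counted from 0. *)
Definition cell lam : finType := {i : 'I_n & 'I_(lam i)}.

Definition is_ssyt lam (T : {ffun cell lam -> 'I_n}) : bool :=
  [forall c : cell lam, forall c' : cell lam,
     ((tag c == tag c') && (tagged c <= tagged c')%N ==> (T c <= T c')%N)
  && ((tag c < tag c')%N && (tagged c == tagged c' :> nat)
        ==> (T c < T c')%N)].

Definition has_weight lam eta (T : {ffun cell lam -> 'I_n}) : bool :=
  [forall k : 'I_n, #|[set c | T c == k]%SET| == eta k].

Definition kostka lam eta : nat :=
  #|[set T : {ffun cell lam -> 'I_n} | is_ssyt T && has_weight eta T]%SET|.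

End Combinatorics.

Arguments partitions n : clear implicits.
Arguments delta n : clear implicits.

Section Polynomials.
Variables (R : realType) (n : nat).
Implicit Types (lam eta mu : multinom n).

Definition msympoly eta : mpoly n R := \sum_(mu <- perms eta) mpolyX R mu.

Definition alternant mu : mpoly n R :=
  \det (\matrix_(i < n, j < n) mpolyX R (mnm1 i) ^+ mu j).

(* The exact quotient in the polynomial ring: since mpoly n R is an integral
   domain and alternant delta <> 0, at most one s satisfies the equation, also
   when alternant delta vanishes at the point where s is evaluated later. *)
Definition schur lam : mpoly n R :=
  xget 0 [set s | s * alternant (delta n) = alternant (mnm_add lam (delta n))].

End Polynomials.

Section OrbitMeasure.
Variables (R : realType) (n : nat).

(* The complex n x n matrices with their Borel sigma-algebra.  Without the cast
   no topology is found on R[i]; with it, R[i] gets the one of its norm. *)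
Definition borel_cmx :=
  g_sigma_algebraType (@open 'M[(R[i]%C : numClosedFieldType)]_n).

Definition unitary_conj (u X : 'M[R[i]%C]_n) : 'M[R[i]%C]_n :=
  u *m X *m invmx u.

Definition real_diag (b : n.-tuple R) : 'M[R[i]%C]_n :=
  diag_mx (\row_i (tnth b i)%:C%C).

Definition unitary_orbit (b : n.-tuple R) : set borel_cmx :=
  [set unitary_conj u (real_diag b) | u in [set u | u \is unitarymx]].

(* nu is the conjugation-invariant probability measure on the orbit of b,
   regarded as a measure on all matrices that is carried by the orbit (which is
   compact, hence Borel). *)
Definition invariant_orbit_probability (b : n.-tuple R)
    (nu : probability borel_cmx R) : Prop :=
  nu (unitary_orbit b) = 1%E /\
  forall (u : 'M[R[i]%C]_n) (A : set borel_cmx),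
    u \is unitarymx -> measurable A -> nu (unitary_conj u @^-1` A) = nu A.

(* Diagonal entries of Hermitian matrices are real, so on the orbits taking real
   parts loses nothing. *)
Definition diag_proj (X : borel_cmx) : n.-tuple R :=
  [tuple complex.Re (X i i) | i < n].

Definition diag_measure (nu : probability borel_cmx R) :
    set (n.-tuple R) -> \bar R :=
  pushforward nu diag_proj.

End OrbitMeasure.

(* Main.v *)
Require Import Defs.
From HB Require Import structures.
From mathcomp Require Import all_boot all_order all_algebra all_fingroup.
From mathcomp Require Import all_classical all_reals all_analysis.
From mathcomp Require Import complex.
From mathcomp Require Import measurable_realfun ring.
From mathcomp.multinomials Require mpoly ssrcomplements.
Import -(notations) mpoly.
Import -(notations) ssrcomplements.

Set Implicit Arguments.
Unset Strict Implicit.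
Unset Printing Implicit Defensive.

Import Order.TTheory GRing.Theory Num.Theory.
Import numFieldNormedType.Exports.
Local Open Scope ring_scope.

(** Let E be the functional that integrates a polynomial in the n^2 entries of
a matrix X over the orbit.  Only two of its properties are used: it is invariant
under unitary conjugation of X, and
  E (det (X - z) F) = prod_i (b_i - z) E F   for every scalar z,
because the characteristic polynomial is constant on the orbit.

Invariance is used in infinitesimal form: E vanishes on the image of the
derivation D_A with D_A X = [A, X].  When A is a Hermitian projection w, the
unitary matrices 1 - w + c w with |c| = 1 conjugate X to a Laurent polynomial in
c, so that invariance is an identity between polynomials in c that holds at
infinitely many points and can be differentiated formally at c = 1
([E_projection_derivation]).  Projections of rank one span all matrices, whence
E (D_kj F) = 0 for the elementary matrices A = e_kj, k <> j
([E_commutator_derivation]).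

The heart of the matter is a determinant identity of Capelli type.  Let p_1, ...,
p_n be polynomials in one variable t.  Then
  E det [((t - z) p_i)^(m) (X_ii)]_(i,m) = E (det (X - z) det [p_i^(m) (X_ii)]_(i,m))
([E_deriv_det_shift]).  Writing y_i for the derivative acting on p_i, the left
determinant is det [(X_ii - z) y_i^m + m y_i^(m-1)], because of the Leibniz
rule, while the right one is the Vandermonde determinant det [y_i^m]; modulo the
images of the D_kj, multiplication by (y_k - y_j) X_jk amounts to - D_kj, and
this turns the correction terms m y_i^(m-1) into the off-diagonal part of
det (X - z) ([Xi_det_twisted]).

Put d (a) = E det [(t^(a_i))^(delta_j) (X_ii)]_(i,j) and extend d linearly from
exponents a to polynomials in n variables.  The previous identity says that
multiplication by prod_i (x_i - z) multiplies d by prod_i (b_i - z); comparing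
powers of z, multiplication by a symmetric polynomial p multiplies d by p (b)
([delta_moment_symmetric]).  In particular, since a_(lam + delta) =
s_lam a_delta, d (lam + delta) = s_lam (b) delta!.

On the other hand, let L (a) = E (prod_i X_ii^(a_i)) and expand the determinant:
d (a) is a! times the coefficient of x^a in a_delta Phi, where Phi is the
exponential generating function sum_a L (a) / a! x^a.  As Phi is symmetric, it is
determined by the coefficients of a_delta Phi at the exponents lam + delta, so
  Phi = sum_lam delta! / (lam + delta)! s_lam (b) s_lam
([moment_poly_schur]).  The coefficient of x^eta is the theorem, once s_lam is
known to be the generating function of the semistandard tableaux of shape lam
([ssyt_sum_bialternant]): deleting the largest entry of a tableau and column
operations on the alternant give the same recursion.

On the analytic side, the spectral theorem describes the orbit as the set of
Hermitian matrices X with det (X - m) = prod_i (b_i - m) for all natural numbers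
m.  Hence it is Borel; since it is also bounded, polynomials are integrable, and
E has the two properties above. *)

(** * Derivations and determinants *)

Section DerivationDet.
Variables (A : comNzRingType) (d : A -> A).
Hypothesis dD : {morph d : a b / a + b}.
Hypothesis dM : forall a b, d (a * b) = d a * b + a * d b.

Lemma derivation0 : d 0 = 0.
Proof. by apply: (addrI (d 0)); rewrite -dD !addr0. Qed.

Lemma derivation1 : d 1 = 0.
Proof. by apply: (addrI (d 1)); rewrite addr0 -{3}(mulr1 1) dM mulr1 mul1r. Qed.

Lemma derivationN a : d (- a) = - d a.
Proof. by apply: (addrI (d a)); rewrite -dD !subrr derivation0. Qed.

Lemma derivation_sum I (r : seq I) (P : pred I) (F : I -> A) :
  d (\sum_(i <- r | P i) F i) = \sum_(i <- r | P i) d (F i).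
Proof. exact: (big_morph d dD derivation0). Qed.

Lemma derivation_prod_seq (I : eqType) (r : seq I) (F : I -> A) : uniq r ->
  d (\prod_(i <- r) F i) =
  \sum_(i <- r) d (F i) * \prod_(i' <- r | i' != i) F i'.
Proof.
elim: r => [|x r IH] /=; first by rewrite !big_nil derivation1.
case/andP=> xr ur; rewrite !big_cons dM eqxx /= IH //.
congr (d _ * _ + _).
  rewrite big_seq [RHS]big_seq_cond; apply: eq_bigl => i.
  by case: eqP => [->|] /=; rewrite ?andbT // (negPf xr).
rewrite mulr_sumr [LHS]big_seq [RHS]big_seq; apply: eq_bigr => i ir.
rewrite big_cons; case: eqP => [E|_]; first by rewrite E ir in xr.
by rewrite mulrCA.
Qed.

Lemma derivation_prod (I : finType) (F : I -> A) :
  d (\prod_i F i) = \sum_i d (F i) * \prod_(i' | i' != i) F i'.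
Proof. by rewrite derivation_prod_seq // index_enum_uniq. Qed.

End DerivationDet.

Section SetRow.
Variables (A : comNzRingType) (n : nat).
Implicit Types (M : 'M[A]_n) (v : 'I_n -> A).

Definition set_row M i v : 'M[A]_n :=
  \matrix_(a, b) if a == i then v b else M a b.

Lemma cofactor_set_row M i v j : cofactor (set_row M i v) i j = cofactor M i j.
Proof.
rewrite /cofactor; congr (_ * \det _); apply/matrixP=> a b.
by rewrite !mxE eq_sym (negPf (neq_lift _ _)).
Qed.

Lemma det_set_row M i v :
  \det (set_row M i v) = \sum_j v j * cofactor M i j.
Proof.
rewrite (expand_det_row _ i); apply: eq_bigr => j _.
by rewrite cofactor_set_row mxE eqxx.
Qed.

Lemma cofactor_det M i j :
  cofactor M i j = \det (set_row M i (fun b => (b == j)%:R)).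
Proof.
rewrite det_set_row (bigD1 j) //= eqxx mul1r big1 ?addr0 // => k kj.
by rewrite (negPf kj) mul0r.
Qed.

Lemma derivation_det (d : A -> A) (M : 'M[A]_n) :
  {morph d : a b / a + b} -> (forall a b, d (a * b) = d a * b + a * d b) ->
  d (\det M) = \sum_i \sum_j d (M i j) * cofactor M i j.
Proof.
move=> dD dM; rewrite /determinant (derivation_sum dD).
have dS (s : 'S_n) a : d ((-1) ^+ s * a) = (-1) ^+ s * d a.
  by case: (odd_perm s); rewrite ?expr1 ?expr0 ?mulN1r ?mul1r ?(derivationN dD).
under eq_bigr do rewrite dS (derivation_prod dM) mulr_sumr.
rewrite exchange_big /=; apply: eq_bigr => i _.
rewrite -(det_set_row M i (fun j => d (M i j))); apply: eq_bigr => s _.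
congr (_ * _); rewrite [RHS](bigD1 i) //= mxE eqxx; congr (_ * _).
by apply: eq_bigr => a ai; rewrite mxE (negPf ai).
Qed.

(** The derivation is the commutator with the elementary matrix e_kj. It only
affects row k of M, where its values are the entries of row j, and column j,
where they are minus those of column k. The cofactor at (j, k) omits row j and
column k, so that the first part yields the principal minor at k (up to a
transposition of rows) and the second the one at j. *)
Lemma derivation_cofactor (d : A -> A) (M : 'M[A]_n) (j k : 'I_n) :
  {morph d : a b / a + b} -> (forall a b, d (a * b) = d a * b + a * d b) ->
  j != k ->
  (forall a b, d (M a b) = (a == k)%:R * M j b - M a k * (b == j)%:R) ->
  d (cofactor M j k) = cofactor M j j - cofactor M k k.
Proof.
move=> dD dM jk dMab; rewrite [X in d X]cofactor_det.
set N := set_row M j _.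
have dN a b : d (N a b) =
    if a == j then 0 else (a == k)%:R * M j b - M a k * (b == j)%:R.
  rewrite mxE; case: ifP => // _.
  by case: (b == k); rewrite ?(derivation1 dM) ?(derivation0 dD).
have cofN b : cofactor N j b = cofactor M j b by exact: cofactor_set_row.
rewrite (derivation_det N dD dM).
pose P a b := (a == k)%:R * M j b * cofactor N a b.
pose Q a b := (a != j)%:R * M a k * (b == j)%:R * cofactor N a b.
have -> : \sum_a \sum_b d (N a b) * cofactor N a b =
          \sum_a \sum_b P a b - \sum_a \sum_b Q a b.
  rewrite -sumrB; apply: eq_bigr => a _; rewrite -sumrB.
  apply: eq_bigr => b _; rewrite dN /P /Q.
  case: (eqVneq a j) => [->|_] /=; last by rewrite mulrBl !mul1r.
  by rewrite (negPf jk) !mul0r subrr.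
have -> : \sum_a \sum_b P a b = - cofactor M k k.
  rewrite (bigD1 k) //= [X in _ + X]big1 ?addr0; last first.
    by move=> a ak; rewrite big1 // => b _; rewrite /P (negPf ak) !mul0r.
  rewrite /P eqxx; under eq_bigr do rewrite mul1r.
  rewrite -(det_set_row N k (M j)) [in RHS]cofactor_det.
  have -> : set_row N k (M j) =
            xrow j k (set_row M k (fun b => (b == k)%:R)).
    apply/matrixP=> a b; rewrite !mxE.
    case: tpermP => [->|->|/eqP aj /eqP ak].
    - by rewrite (negPf jk) !eqxx.
    - by rewrite eqxx (negPf jk).
    by rewrite (negPf aj) (negPf ak).
  by rewrite xrowE det_mulmx det_perm odd_tperm jk expr1 mulN1r.
have -> : \sum_a \sum_b Q a b = - cofactor M j j; last by rewrite opprK addrC.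
(* column k of N is orthogonal to the cofactors along column j, so the sum over
   the rows other than j is minus the term of row j *)
have := congr1 (fun B : 'M[A]_n => B j k) (mul_adj_mx N).
rewrite /mulmx !mxE (negPf jk) mulr0n (bigD1 j) //= !mxE !eqxx mulr1 cofN.
move/eqP; rewrite addrC addr_eq0 => /eqP <-.
rewrite (bigD1 j) //= [X in X + _]big1 ?add0r; last first.
  by move=> b _; rewrite /Q eqxx !mul0r.
apply: eq_bigr => a aj; rewrite (bigD1 j) //= [X in _ + X]big1 ?addr0.
  by rewrite /Q aj eqxx mul1r mulr1 !mxE (negPf aj) mulrC.
by move=> b bj; rewrite /Q (negPf bj) mulr0 mul0r.
Qed.

End SetRow.

Section LinearFormsDet.
Variables (A : comNzRingType) (N : nat) (phi : 'I_N.+1 -> {poly A} -> A).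
Hypothesis phiD : forall i p q, phi i (p + q) = phi i p + phi i q.
Hypothesis phiZ : forall i c p, phi i (c *: p) = c * phi i p.

(** Column operations replace the last column of monomials by a monic
polynomial of the same degree; the determinant is then expanded along that
column. *)
Lemma det_linear_forms (Q : {poly A}) : Q \is monic -> size Q = N.+1 ->
  \det (\matrix_(i < N.+1, m < N.+1) phi i 'X^m) =
  \sum_i phi i Q * ((-1) ^+ (i + N)
     * \det (\matrix_(a < N, m < N) phi (lift i a) 'X^m)).
Proof.
move=> Qm Qs; set M := \matrix_(_, _) _.
pose U : 'M[A]_N.+1 :=
  \matrix_(m, m') if m' == ord_max then Q`_m else (m == m')%:R.
have detU : \det U = 1.
  rewrite -det_tr det_trig; last first.
    apply/is_trig_mxP => i j ij; rewrite !mxE.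
    have /negPf -> : i != ord_max.
      by apply: contraL ij => /eqP ->; rewrite -leqNgt -ltnS.
    by rewrite gt_eqF.
  rewrite big_ord_recr big1 => [|i _]; rewrite !mxE.
    move/monicP: Qm; rewrite /lead_coef Qs /= => ->.
    by rewrite eqxx mul1r.
  by rewrite eqxx -val_eqE /= (ltn_eqF (ltn_ord i)).
have -> : \det M = \det (M *m U) by rewrite det_mulmx detU mulr1.
rewrite (expand_det_col _ ord_max).
have MU i m : (M *m U) i m = if m == ord_max then phi i Q else phi i 'X^m.
  rewrite mxE; case: eqP => [->|/eqP mm].
    rewrite -[Q in RHS]coefK poly_def Qs.
    have -> : phi i (\sum_(i0 < N.+1) Q`_i0 *: 'X^i0) =
              \sum_(i0 < N.+1) phi i (Q`_i0 *: 'X^i0).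
      apply: (big_morph _ (phiD i)).
      by have := phiZ i 0 0; rewrite scale0r mul0r.
    by apply: eq_bigr => j _; rewrite !mxE eqxx phiZ mulrC.
  rewrite (bigD1 m) //= big1 => [|j jm]; last first.
    by rewrite !mxE (negPf mm) (negPf jm) mulr0.
  by rewrite !mxE (negPf mm) eqxx mulr1 addr0.
apply: eq_bigr => i _; rewrite MU eqxx /cofactor; do 2!congr (_ * _).
congr (\det _).
apply/matrixP=> a m; rewrite !mxE.
have E : nat_of_ord (lift ord_max m) = m by rewrite /= /bump leqNgt ltn_ord.
transitivity ((M *m U) (lift i a) (lift ord_max m)); first by rewrite !mxE.
by rewrite MU eq_sym (negPf (neq_lift _ _)) E.
Qed.

End LinearFormsDet.

(** * A determinant identity of Capelli type *)

Section TwistedDeterminant.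
Variables (A : idomainType) (V : zmodType) (n : nat).
Variables (X : 'M[A]_n) (y : 'I_n -> A) (D : 'I_n -> 'I_n -> A -> A).
Variable Xi : {additive A -> V}.
Hypothesis DD : forall k j, {morph D k j : a b / a + b}.
Hypothesis DM : forall k j a b, D k j (a * b) = D k j a * b + a * D k j b.
Hypothesis DX : forall k j a b,
  D k j (X a b) = (a == k)%:R * X j b - X a k * (b == j)%:R.
Hypothesis Dy : forall k j i, D k j (y i) = 0.
Hypothesis y_inj : injective y.
Hypothesis XiD : forall k j F, k != j ->
  Xi (D k j F) = - Xi ((y k - y j) * (X j k * F)).

(** The entry is the value at t = y i of (x + d/dt) t^m, where x is the
diagonal entry of X: multiplication by the variable and differentiation, seen
through the substitution of y for the derivative. *)
Definition twisted_mx N (f : 'I_N -> 'I_n) : 'M[A]_N :=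
  \matrix_(i, m) (X (f i) (f i) * y (f i) ^+ m + y (f i) ^+ m.-1 *+ m).

Definition vdm_mx N (f : 'I_N -> 'I_n) : 'M[A]_N :=
  \matrix_(i, m) y (f i) ^+ m.

Let D0 k j : D k j 0 = 0. Proof. exact: derivation0. Qed.
Let D1 k j : D k j 1 = 0. Proof. exact: derivation1. Qed.
Let DN k j a : D k j (- a) = - D k j a. Proof. exact: derivationN. Qed.

Let DM0 k j a b : D k j a = 0 -> D k j b = 0 -> D k j (a * b) = 0.
Proof. by move=> a0 b0; rewrite DM a0 b0 mul0r mulr0 addr0. Qed.

Let Dprod0 k j (I : Type) (r : seq I) (P : pred I) (F : I -> A) :
  (forall i, D k j (F i) = 0) -> D k j (\prod_(i <- r | P i) F i) = 0.
Proof. by move=> F0; elim/big_ind: _ => // a b; apply: DM0. Qed.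

Let Dexp0 k j a m : D k j a = 0 -> D k j (a ^+ m) = 0.
Proof. by move=> a0; elim: m => [|m IH]; rewrite ?expr0 // exprS DM0. Qed.

Let Dsign k j m : D k j ((-1) ^+ m) = 0.
Proof. by apply: Dexp0; rewrite DN D1 oppr0. Qed.

Let DyB k j a b : D k j (y a - y b) = 0.
Proof. by rewrite DD DN !Dy oppr0 addr0. Qed.

Let Dvdm k j N (f : 'I_N -> 'I_n) : D k j (\det (vdm_mx f)) = 0.
Proof.
rewrite derivation_det // big1 // => a _; rewrite big1 // => b _.
by rewrite mxE Dexp0 ?mul0r.
Qed.

Let vdm_expand N (f : 'I_N.+1 -> 'I_n) (Q : {poly A}) :
  Q \is monic -> size Q = N.+1 ->
  \det (vdm_mx f) = \sum_i Q.[y (f i)] * ((-1) ^+ (i + N)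
     * \det (vdm_mx (f \o lift i))).
Proof.
move=> Qm Qs; pose phi (i : 'I_N.+1) (p : {poly A}) := p.[y (f i)].
have phiD i p q : phi i (p + q) = phi i p + phi i q by rewrite /phi hornerD.
have phiZ i c p : phi i (c *: p) = c * phi i p by rewrite /phi hornerZ.
have E := det_linear_forms phiD phiZ Qm Qs.
have -> : vdm_mx f = \matrix_(i, m) phi i 'X^m.
  by apply/matrixP=> i m; rewrite !mxE /phi hornerXn.
rewrite E; apply: eq_bigr => i _; do 2!congr (_ * _); congr (\det _).
by apply/matrixP=> a m; rewrite !mxE /phi hornerXn.
Qed.

Let twisted_expand N (f : 'I_N.+1 -> 'I_n) (Q : {poly A}) :
  Q \is monic -> size Q = N.+1 ->
  \det (twisted_mx f) =
  \sum_i (X (f i) (f i) * Q.[y (f i)] + Q^`().[y (f i)]) * ((-1) ^+ (i + N)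
     * \det (twisted_mx (f \o lift i))).
Proof.
move=> Qm Qs; pose phi (i : 'I_N.+1) (p : {poly A}) :=
  X (f i) (f i) * p.[y (f i)] + p^`().[y (f i)].
have phiD i p q : phi i (p + q) = phi i p + phi i q.
  by rewrite /phi derivD !hornerD mulrDr addrACA.
have phiZ i c p : phi i (c *: p) = c * phi i p.
  by rewrite /phi derivZ !hornerZ mulrDr mulrCA.
have E := det_linear_forms phiD phiZ Qm Qs.
have -> : twisted_mx f = \matrix_(i, m) phi i 'X^m.
  by apply/matrixP=> i m; rewrite !mxE /phi derivXn hornerMn !hornerXn.
rewrite E; apply: eq_bigr => i _; do 2!congr (_ * _); congr (\det _).
by apply/matrixP=> a m; rewrite !mxE /phi derivXn hornerMn !hornerXn.
Qed.

Let prod_lift N (j : 'I_N.+1) (P : pred 'I_N.+1) (F : 'I_N.+1 -> A) :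
  \prod_(b < N | P (lift j b)) F (lift j b) =
  \prod_(i < N.+1 | (i != j) && P i) F i.
Proof.
rewrite [RHS]big_mkcond (bigD1_ord j) //= eqxx mul1r big_mkcond.
by apply: eq_bigr => b _; rewrite eq_sym neq_lift.
Qed.

(** Induction on N. Let k be the last index and Q j the monic polynomial of
degree N that vanishes at the y (f i) with i <> j. With Q k in the last
column, the expansion of the Vandermonde determinant has the single term j =
k, and that of the twisted one has coefficients X_jj Q_k (y_j) + Q_k' (y_j),
where the first summand vanishes unless j = k. By induction the complementary
minors become principal minors dt j of X times Vandermonde minors v j. The
derivatives Q_k' combine into terms g (dt k - dt j); as dt k - dt j is minus
the derivative D_kj of the cofactor at (j, k), the hypothesis on Xi converts
each of them into a term X_jk cofactor_jk of the expansion of det X along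
column k. The factor h is there for the induction, where it absorbs the
constants for the derivations. *)
Lemma Xi_det_twisted N (f : 'I_N -> 'I_n) (h : A) : injective f ->
  (forall a b, a != b -> D (f a) (f b) h = 0) ->
  Xi (\det (twisted_mx f) * h) =
  Xi (\det (mxsub f f X) * (\det (vdm_mx f) * h)).
Proof.
elim: N f h => [|N IH] f h f_inj h0.
  by rewrite !det_mx00 !mul1r.
pose k : 'I_N.+1 := ord_max.
pose v (j : 'I_N.+1) := (-1) ^+ (j + N) * \det (vdm_mx (f \o lift j)).
pose Q (j : 'I_N.+1) : {poly A} := \prod_(b < N) ('X - (y (f (lift j b)))%:P).
have Qm j : Q j \is monic by apply: monic_prod_XsubC.
have Qs j : size (Q j) = N.+1.
  by rewrite size_prod_XsubC /index_enum -enumT size_enum_ord.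
have Qh j t : (Q j).[t] = \prod_(b < N) (t - y (f (lift j b))).
  by rewrite horner_prod; apply: eq_bigr => b _; rewrite hornerXsubC.
have Q'h j t : (Q j)^`().[t] =
    \sum_(a < N) \prod_(b < N | b != a) (t - y (f (lift j b))).
  rewrite (@derivation_prod _ (@deriv A)); last exact: derivM.
  rewrite horner_sum; apply: eq_bigr => a _.
  rewrite derivXsubC mul1r horner_prod.
  by apply: eq_bigr => b _; rewrite hornerXsubC.
set W := \det (vdm_mx f).
have vQ j : (Q j).[y (f j)] * v j = W.
  rewrite /W (vdm_expand f (Qm j) (Qs j)) (bigD1 j) //= big1 ?addr0 // => i ij.
  have /unlift_some [b -> _] : j != i by rewrite eq_sym.
  by rewrite Qh (bigD1 b) //= subrr !mul0r.
(* (y_k - y_j) g = W: dividing the Vandermonde determinant by y_k - y_j provides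
   the factor needed to apply XiD *)
pose g (a : 'I_N) :=
  \prod_(b < N | b != a) (y (f k) - y (f (lift k b))) * v k.
have gW a : (y (f k) - y (f (lift k a))) * g a = W.
  by rewrite /g mulrA -(vQ k) Qh [in RHS](bigD1 a).
have gE a : g a = - (Q k)^`().[y (f (lift k a))] * v (lift k a).
  have ya : y (f k) - y (f (lift k a)) != 0.
    by rewrite subr_eq0 (inj_eq y_inj) (inj_eq f_inj) neq_lift.
  apply: (mulfI ya); rewrite gW -(vQ (lift k a)) [RHS]mulrA; congr (_ * v _).
  rewrite mulrN -mulNr opprB Q'h (bigD1 a) //= [X in _ * (_ + X)]big1 => [|c ca].
    rewrite addr0 Qh; set t := y (f (lift k a)).
    rewrite (prod_lift (lift k a) xpredT (fun i => t - y (f i))).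
    have -> : \prod_(b < N | b != a) (t - y (f (lift k b))) =
        \prod_(i < N.+1 | (i != k) && (i != lift k a)) (t - y (f i)).
      rewrite -(prod_lift k (fun i => i != lift k a) (fun i => t - y (f i))).
      by apply: eq_bigl => b; rewrite (inj_eq lift_inj).
    rewrite (bigD1 k) /=; last by rewrite andbT neq_lift.
    by congr (_ * _); apply: eq_bigl => i; rewrite andbT andbC.
  by rewrite (bigD1 a) 1?eq_sym //= subrr mul0r.
have gsum : (Q k)^`().[y (f k)] * v k = \sum_a g a.
  by rewrite Q'h mulr_suml.
pose dt j := cofactor (mxsub f f X) j j.
have dtE j : \det (mxsub (f \o lift j) (f \o lift j) X) = dt j.
  rewrite /dt /cofactor -signr_odd addnn odd_double mul1r; congr (\det _).
  by apply/matrixP=> a b; rewrite !mxE.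
pose c j := X (f j) (f j) * (Q k).[y (f j)] + (Q k)^`().[y (f j)].
have Dc a b j : a != b ->
    D (f (lift j a)) (f (lift j b)) (c j) = 0.
  move=> ab; have xj : D (f (lift j a)) (f (lift j b)) (X (f j) (f j)) = 0.
    rewrite DX !(inj_eq f_inj) (negPf (neq_lift _ _)) mul0r.
    by rewrite (negPf (neq_lift _ _)) mulr0 subrr.
  rewrite DD DM0 ?add0r //; last by rewrite Qh Dprod0.
  rewrite Q'h derivation_sum // big1 // => i _; exact: Dprod0.
have Dv a b j : D a b (v j) = 0 by rewrite DM0.
have step j : Xi (c j * ((-1) ^+ (j + N) * \det (twisted_mx (f \o lift j))) * h)
    = Xi (c j * v j * dt j * h).
  have -> : c j * ((-1) ^+ (j + N) * \det (twisted_mx (f \o lift j))) * h =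
      \det (twisted_mx (f \o lift j)) * (c j * (-1) ^+ (j + N) * h) by ring.
  rewrite IH; last 2 first.
  - by move=> a b /= /f_inj /lift_inj.
  - move=> a b ab /=; apply: DM0; last first.
      by apply: h0; rewrite (inj_eq lift_inj).
    by apply: DM0 => //; apply: Dc.
  by rewrite dtE /v; congr (Xi _); ring.
rewrite (twisted_expand f (Qm k) (Qs k)) mulr_suml raddf_sum /=.
under eq_bigr do rewrite step.
have rel a : Xi (g a * (dt k - dt (lift k a)) * h) =
    Xi (X (f (lift k a)) (f k) * cofactor (mxsub f f X) (lift k a) k * W * h).
  set j := lift k a; pose F := cofactor (mxsub f f X) j k * (g a * h).
  have kj : f k != f j by rewrite (inj_eq f_inj) neq_lift.
  have jk : j != k by rewrite eq_sym neq_lift.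
  have -> : X (f j) (f k) * cofactor (mxsub f f X) j k * W * h =
      (y (f k) - y (f j)) * (X (f j) (f k) * F).
    by rewrite -(gW a) /F; ring.
  apply: oppr_inj; rewrite -XiD // -raddfN; congr (Xi _).
  rewrite /F DM (derivation_cofactor _ _ jk) //; last first.
    by move=> b e; rewrite !mxE DX !(inj_eq f_inj).
  rewrite [D _ _ (g a * h)]DM0; last 2 first.
  - by rewrite /g DM0 // Dprod0.
  - by apply: h0; rewrite neq_lift.
  by rewrite /dt; ring.
rewrite -raddf_sum /= (bigD1_ord k) //=.
have -> : c k * v k = X (f k) (f k) * W + \sum_a g a.
  by rewrite -gsum /c -(vQ k); ring.
rewrite [X in X + _](_ : _ = X (f k) (f k) * dt k * W * h +
   \sum_a g a * dt k * h); last by rewrite -!mulr_suml; ring.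
rewrite -addrA -big_split /= raddfD raddf_sum /=.
under eq_bigr => a _.
  have -> : g a * dt k * h + c (lift k a) * v (lift k a) * dt (lift k a) * h =
    g a * (dt k - dt (lift k a)) * h.
    rewrite /c.
    have -> : (Q k).[y (f (lift k a))] = 0.
      by rewrite Qh (bigD1 a) //= subrr mul0r.
    by rewrite mulr0 add0r mulrBr mulrBl -mulNr -mulNr gE; ring.
  rewrite rel; over.
rewrite -raddf_sum -raddfD /=; congr (Xi _).
rewrite (expand_det_col _ k) (bigD1_ord k) //= !mulrDl mxE mulrA; congr (_ + _).
rewrite mulr_suml; apply: eq_bigr => a _; rewrite mxE /W; ring.
Qed.

End TwistedDeterminant.

(** * Linear functionals on polynomials *)

Section LinearExtension.
Variables (n : nat) (R : comNzRingType) (v : multinom n -> R).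

Definition mpoly_lin (p : mpoly n R) : R :=
  \sum_(m <- msupp p) mcoeff m p * v m.

Lemma mpoly_linwE k p : (mmeasure mdeg p <= k)%N ->
  mpoly_lin p = \sum_(m : bmultinom n k) mcoeff m p * v m.
Proof.
move=> le_pk; rewrite /mpoly_lin (big_mksub (bmultinom n k)) ?msupp_uniq //=.
  by rewrite big_rmcond //= => m /memN_msupp_eq0 ->; rewrite mul0r.
by move=> m /msize_mdeg_lt /leq_trans; apply.
Qed.

Lemma mpoly_lin_is_linear : scalar mpoly_lin.
Proof.
move=> c p q /=.
pose k := maxn (mmeasure mdeg (c *: p + q)) (maxn (mmeasure mdeg p) (mmeasure mdeg q)).
rewrite !(mpoly_linwE (k := k)) /k ?leq_max ?leqnn ?orbT //.
rewrite mulr_sumr -big_split; apply: eq_bigr => m _ /=.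
by rewrite mcoeffD mcoeffZ mulrDl mulrA.
Qed.

HB.instance Definition _ :=
  GRing.isLinear.Build R (mpoly n R) R *%R mpoly_lin mpoly_lin_is_linear.

Lemma mpoly_linX m : mpoly_lin (mpolyX R m) = v m.
Proof. by rewrite /mpoly_lin msuppX big_seq1 mcoeffX eqxx mul1r. Qed.

Lemma mpoly_lin_prod (T : finType) (c : 'I_n -> T -> R) (r : 'I_n -> T -> nat) :
  mpoly_lin (\prod_i \sum_t c i t *: mpolyX R (mnm1 i) ^+ r i t) =
  \sum_(e : {ffun 'I_n -> T})
    \prod_i c i (e i) * v (Multinom [tuple r i (e i) | i < n]).
Proof.
rewrite bigA_distr_bigA raddf_sum /=; apply: eq_bigr => e _.
have -> : \prod_i (c i (e i) *: mpolyX R (mnm1 i) ^+ r i (e i)) =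
          (\prod_i c i (e i)) *: mpolyX R (Multinom [tuple r i (e i) | i < n]).
  rewrite [mpolyX R (Multinom _)]mpolyXE_id -scaler_prod.
  by apply: eq_bigr => i _; rewrite mnmE.
by rewrite linearZ /= mpoly_linX.
Qed.

End LinearExtension.

Lemma det_multilinear (R : comNzRingType) n (T : finType)
    (c : 'I_n -> T -> R) (G : 'I_n -> T -> 'I_n -> R) :
  \det (\matrix_(i, j) \sum_t c i t * G i t j) =
  \sum_(e : {ffun 'I_n -> T})
    \prod_i c i (e i) * \det (\matrix_(i, j) G i (e i) j).
Proof.
rewrite /determinant; under [RHS]eq_bigr do rewrite mulr_sumr.
rewrite exchange_big; apply: eq_bigr => s _ /=.
transitivity ((-1) ^+ s * \prod_i \sum_t c i t * G i t (s i)).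
  by congr (_ * _); apply: eq_bigr => i _; rewrite mxE.
rewrite bigA_distr_bigA mulr_sumr; apply: eq_bigr => e _.
rewrite big_split mulrCA; do 2!congr (_ * _).
by apply: eq_bigr => i _; rewrite mxE.
Qed.

Section CoefficientwiseDerivation.
Variables (B : comNzRingType) (n : nat) (d : {additive B -> B}).
Hypothesis dM : forall a b, d (a * b) = d a * b + a * d b.

Lemma map_mpoly_derivation (p q : mpoly n B) :
  map_mpoly d (p * q) = map_mpoly d p * q + p * map_mpoly d q.
Proof.
apply/mpolyP=> m; rewrite mcoeffD mcoeff_map_mpoly !mcoeffM raddf_sum /=.
rewrite -big_split; apply: eq_bigr => k _ /=.
by rewrite dM !mcoeff_map_mpoly.
Qed.

Lemma map_mpoly_derivationX (m : multinom n) : map_mpoly d (mpolyX B m) = 0.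
Proof.
apply/mpolyP=> k; rewrite mcoeff_map_mpoly mcoeff0 mcoeffX.
by case: eqP => _; rewrite ?raddf0 // (derivation1 dM).
Qed.

End CoefficientwiseDerivation.

(** * Determinants of derivatives on the diagonal *)

Section MatrixFunctional.
Variables (K : fieldType) (B : idomainType) (iota : {rmorphism K -> B}).
Variables (n : nat) (X0 : 'M[B]_n).
Variables (D : 'I_n -> 'I_n -> {additive B -> B}) (E : {additive B -> K}).
Hypothesis DM : forall k j a b, D k j (a * b) = D k j a * b + a * D k j b.
Hypothesis DX : forall k j a b,
  D k j (X0 a b) = (a == k)%:R * X0 j b - X0 a k * (b == j)%:R.
Hypothesis Diota : forall k j c, D k j (iota c) = 0.
Hypothesis ED : forall k j F, k != j -> E (D k j F) = 0.

Definition ev_diag (i : 'I_n) (q : {poly K}) : B :=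
  (map_poly iota q).[X0 i i].

Lemma ev_diagD i p q : ev_diag i (p + q) = ev_diag i p + ev_diag i q.
Proof. by rewrite /ev_diag rmorphD hornerD. Qed.

Lemma ev_diagM i p q : ev_diag i (p * q) = ev_diag i p * ev_diag i q.
Proof. by rewrite /ev_diag rmorphM hornerM. Qed.

Lemma ev_diagC i c : ev_diag i c%:P = iota c.
Proof. by rewrite /ev_diag map_polyC hornerC. Qed.

Lemma ev_diagX i : ev_diag i 'X = X0 i i.
Proof. by rewrite /ev_diag map_polyX hornerX. Qed.

Lemma ev_diagMn i p m : ev_diag i (p *+ m) = ev_diag i p *+ m.
Proof. by rewrite /ev_diag rmorphMn hornerMn. Qed.

Lemma D_ev_diag k j i q :
  D k j (ev_diag i q) = ev_diag i q^`() * D k j (X0 i i).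
Proof.
elim/poly_ind: q => [|q c IH].
  by rewrite deriv0 /ev_diag rmorph0 horner0 mul0r raddf0.
rewrite derivD derivC addr0 derivM derivX mulr1 !ev_diagD !ev_diagM ev_diagC.
by rewrite ev_diagX raddfD Diota addr0 /= DM IH; ring.
Qed.

Section Family.
Variable p : 'I_n -> {poly K}.

(** The monomial y^m of the symbolic calculus stands for this product: y_i
acts as the derivative on p_i. *)
Definition ev_deriv (m : multinom n) : B := \prod_i ev_diag i (p i)^`(m i).

Lemma D_ev_deriv k j m : k != j ->
  D k j (ev_deriv m) = X0 j k * (ev_deriv (mnm_add m (mnm1 k))
                                 - ev_deriv (mnm_add m (mnm1 j))).
Proof.
move=> kj; rewrite /ev_deriv (derivation_prod (DM k j)).
have S l : \prod_i ev_diag i (p i)^`(mnm_add m (mnm1 l) i) =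
   ev_diag l (p l)^`((m l).+1) * \prod_(i | i != l) ev_diag i (p i)^`(m i).
  rewrite (bigD1 l) //= mnmDE mnm1E eqxx addn1; congr (_ * _).
  by apply: eq_bigr => i il; rewrite mnmDE mnm1E eq_sym (negPf il) addn0.
rewrite [LHS](bigD1 k) //= [X in _ + X](bigD1 j) 1?eq_sym //= [X in _ + (_ + X)]big1 ?addr0; last first.
  move=> i /andP[ik ij]; rewrite D_ev_diag DX (negPf ik) (negPf ij).
  by rewrite mul0r mulr0 subrr mulr0 mul0r.
rewrite !S !D_ev_diag !DX !eqxx (negPf kj) eq_sym (negPf kj) !derivnS.
by rewrite !mul0r !mulr0 !mul1r !mulr1 subr0 sub0r; ring.
Qed.

Let Y (i : 'I_n) : mpoly n B := mpolyX B (mnm1 i).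
Let Xi : {additive mpoly n B -> K} := E \o mpoly_lin ev_deriv.
Let DA k j (F : mpoly n B) : mpoly n B := map_mpoly (D k j) F.

(** For a monomial c y^m, E kills D_kj (c * ev_deriv m). The Leibniz rule
splits this into the derivative of the coefficient c, which is the left-hand
side, and that of ev_deriv m. The latter moves only the diagonal entries k and
j, by X_jk and - X_jk, and so raises the order of one derivative; this is the
multiplication by y_k - y_j. *)
Let Xi_DA k j F : k != j ->
  Xi (DA k j F) = - Xi ((Y k - Y j) * (mpolyC n (X0 j k) * F)).
Proof.
move=> kj; apply/eqP; rewrite -addr_eq0 -raddfD; apply/eqP.
rewrite /DA; elim/mpolyind: F => [|c m F _ _ IH].
  by rewrite raddf0 !mulr0 addr0 raddf0.
rewrite [map_mpoly _ _]raddfD /= !mulrDr addrACA [mpoly_lin _ _]raddfD [LHS]raddfD /=.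
transitivity (0 + 0 : K); last by rewrite addr0.
congr (_ + _); last exact: IH.
rewrite -mul_mpolyC map_mpoly_derivation // map_mpolyC map_mpoly_derivationX //.
rewrite mulr0 addr0.
have -> : (Y k - Y j) * (mpolyC n (X0 j k) * (mpolyC n c * mpolyX B m)) =
   (X0 j k * c) *: mpolyX B (mnm_add m (mnm1 k))
   - (X0 j k * c) *: mpolyX B (mnm_add m (mnm1 j)).
  by rewrite !mpolyXD -!mul_mpolyC mpolyCM /Y; ring.
rewrite /Xi /= mul_mpolyC raddfD raddfB /= !linearZ /= !mpoly_linX.
rewrite -(ED (c * ev_deriv m) kj) DM D_ev_deriv //.
by congr (E _); ring.
Qed.

Let theta_prod (T : finType) (c : 'I_n -> T -> B) (r : 'I_n -> T -> nat) :
  mpoly_lin ev_deriv (\prod_i \sum_t c i t *: Y i ^+ r i t) =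
  \prod_i \sum_t c i t * ev_diag i (p i)^`(r i t).
Proof.
rewrite mpoly_lin_prod bigA_distr_bigA; apply: eq_bigr => e _.
rewrite big_split; congr (_ * _); apply: eq_bigr => i _.
by rewrite mnmE.
Qed.

Let derivn_XsubC_mul (z : K) (q : {poly K}) m :
  (('X - z%:P) * q)^`(m) = ('X - z%:P) * q^`(m) + q^`(m.-1) *+ m.
Proof.
elim: m => [|m IH]; first by rewrite !derivn0 mulr0n addr0.
rewrite derivnS IH derivD derivM derivXsubC mul1r derivMn -derivnS /=.
case: m {IH} => [|m]; first by rewrite !derivn0 mulr0n addr0 mulr1n addrC.
by rewrite -!derivnS [in RHS]mulrS addrCA addrA.
Qed.

Definition deriv_det (q : 'I_n -> {poly K}) : B :=
  \det (\matrix_(i, m) ev_diag i (q i)^`(m)).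

(** [Xi_det_twisted] for X0 - z and the functional that substitutes
derivatives for the variables y. *)
Lemma E_deriv_det_shift (z : K) :
  E (deriv_det (fun i => ('X - z%:P) * p i)) =
  E (\det (X0 - (iota z)%:M) * deriv_det p).
Proof.
pose X : 'M[mpoly n B]_n := map_mx (@mpolyC n B) (X0 - (iota z)%:M).
have Y_inj : injective Y.
  move=> i j /(congr1 (mcoeff (mnm1 i))); rewrite !mcoeffX eqxx eq_mnm1.
  by case: eqP => [->//|_] /eqP; rewrite oner_eq0.
have XE a b : X a b = mpolyC n (X0 a b - (iota z) *+ (a == b)).
  by rewrite !mxE.
have DAD k j : {morph DA k j : a b / a + b} by move=> a b; rewrite /DA raddfD.
have DAM k j a b : DA k j (a * b) = DA k j a * b + a * DA k j b.
  by apply: map_mpoly_derivation.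
have DAX k j a b :
    DA k j (X a b) = (a == k)%:R * X j b - X a k * (b == j)%:R.
  rewrite /DA !XE map_mpolyC raddfB raddfMn /= Diota mul0rn subr0 DX.
  rewrite -!mpolyC_nat -!mpolyCM -mpolyCB; congr (mpolyC n _).
  case: (eqVneq a k) => [->|ak]; case: (eqVneq b j) => [->|bj];
    rewrite ?(mulr1n, mulr0n, mul0r, mulr0, mul1r, mulr1, subr0, sub0r) //.
  by rewrite opprB addrA subrK.
have DAY k j i : DA k j (Y i) = 0 by apply: map_mpoly_derivationX.
have XiDA k j F : k != j ->
    Xi (DA k j F) = - Xi ((Y k - Y j) * (X j k * F)).
  move=> kj; rewrite Xi_DA // XE eq_sym (negPf kj) mulr0n subr0 //.
have DA1 (a b : 'I_n) : a != b -> DA a b 1 = 0.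
  by rewrite /DA -mpolyC1 map_mpolyC (derivation1 (DM _ _)).
have := Xi_det_twisted DAD DAM DAX DAY Y_inj XiDA (@inj_id _) DA1.
rewrite !mulr1.
have sgn (s : 'S_n) (F : mpoly n B) :
    mpoly_lin ev_deriv ((-1) ^+ s * F) = (-1) ^+ s * mpoly_lin ev_deriv F.
  by case: (odd_perm s); rewrite ?expr1 ?expr0 ?mulN1r ?mul1r ?raddfN.
have -> : \det (mxsub id id X) = mpolyC n (\det (X0 - (iota z)%:M)).
  rewrite -det_map_mx; congr (\det _).
  by apply/matrixP=> a b; rewrite !mxE.
rewrite mul_mpolyC /Xi /= linearZ /= => H.
have -> : deriv_det (fun i => ('X - z%:P) * p i) =
    mpoly_lin ev_deriv (\det (twisted_mx X Y id)).
  rewrite [in RHS]/determinant raddf_sum; apply: eq_bigr => s _.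
  rewrite /= sgn; congr (_ * _).
  pose c i (t : bool) := if t then X0 i i - iota z else (s i)%:R.
  pose r i (t : bool) := if t then nat_of_ord (s i) else (s i).-1.
  transitivity (\prod_i \sum_t c i t * ev_diag i (p i)^`(r i t)).
    apply: eq_bigr => i _; rewrite big_bool mxE derivn_XsubC_mul.
    rewrite ev_diagD ev_diagM ev_diagMn /c /r /= mulr_natl; congr (_ * _ + _).
    by rewrite /ev_diag rmorphB /= map_polyX map_polyC /= hornerXsubC.
  rewrite -theta_prod; congr (mpoly_lin _ _); apply: eq_bigr => i _.
  rewrite big_bool mxE /c /r /= XE eqxx mulr1n -mul_mpolyC -mul_mpolyC.
  by rewrite mpolyC_nat mulr_natl.
rewrite H; congr (E (_ * _)).
rewrite /determinant raddf_sum; apply: eq_bigr => s _; rewrite /= sgn.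
congr (_ * _).
transitivity (mpoly_lin ev_deriv
                (\prod_i \sum_(t : unit) 1 *: Y i ^+ (s i))).
  congr (mpoly_lin _ _); apply: eq_bigr => i _.
  by rewrite big_const card_unit /= addr0 scale1r mxE.
rewrite (theta_prod (fun _ _ => 1) (fun i _ => s i)).
apply: eq_bigr => i _.
by rewrite big_const card_unit /= addr0 mul1r mxE.
Qed.

End Family.
End MatrixFunctional.

(** * The alternating moments are multiplicative over symmetric polynomials *)

Lemma poly_eq0_inj (K : fieldType) (r : {poly K}) (f : nat -> K) :
  injective f -> (forall m, r.[f m] = 0) -> r = 0.
Proof.
move=> f_inj r0; apply/eqP; apply: contraT => nz_r.
pose rs : seq K := [seq f m | m <- iota 0 (size r)].
have := @max_poly_roots _ r rs nz_r.
rewrite size_map size_iota ltnn; apply.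
  by apply/allP => z /mapP[m _ ->]; apply/rootP.
by rewrite map_inj_uniq ?iota_uniq.
Qed.

Lemma poly_eq0_nat (K : numFieldType) (r : {poly K}) :
  (forall m : nat, r.[m%:R] = 0) -> r = 0.
Proof.
by apply: poly_eq0_inj => i j /eqP; rewrite eqr_nat => /eqP.
Qed.

Lemma prod_subC (R : comNzRingType) n (F : 'I_n -> R) w :
  \prod_i (w - F i) = (-1) ^+ n * \prod_i (F i - w).
Proof.
under eq_bigr do rewrite -opprB -mulN1r.
by rewrite big_split /= prodr_const card_ord.
Qed.

Lemma mesym_variables n (K : comNzRingType) k :
  meval (fun i : 'I_n => mpolyX K (mnm1 i)) (mesym n (mpoly n K) k) =
  mesym n K k.
Proof.
rewrite /mesym raddf_sum /=; apply: eq_bigr => h _.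
by rewrite rmorph_prod; apply: eq_bigr => i _; rewrite /= mevalXU.
Qed.

Lemma derivn_sumZ (R : nzRingType) (I : finType) (c : I -> R)
    (p : I -> {poly R}) m :
  (\sum_i c i *: p i)^`(m) = \sum_i c i *: (p i)^`(m).
Proof.
apply/polyP=> l; rewrite coef_derivn !coef_sum -sumrMnl.
by apply: eq_bigr => i _; rewrite !coefZ coef_derivn mulrnAr.
Qed.

Section SymmetricMultiplication.
Variables (K : numFieldType) (B : idomainType) (iota : {rmorphism K -> B}).
Variables (n : nat) (X0 : 'M[B]_n).
Variables (D : 'I_n -> 'I_n -> {additive B -> B}) (E : {additive B -> K}).
Hypothesis DM : forall k j a b, D k j (a * b) = D k j a * b + a * D k j b.
Hypothesis DX : forall k j a b,
  D k j (X0 a b) = (a == k)%:R * X0 j b - X0 a k * (b == j)%:R.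
Hypothesis Diota : forall k j c, D k j (iota c) = 0.
Hypothesis ED : forall k j F, k != j -> E (D k j F) = 0.
Variable b : 'I_n -> K.
Hypothesis Eiota : forall c F, E (iota c * F) = c * E F.
Hypothesis Echi : forall z F,
  E (\det (X0 - (iota z)%:M) * F) = (\prod_i (b i - z)) * E F.

Local Notation ev := (ev_diag iota X0).

Definition delta_det (q : 'I_n -> {poly K}) : B :=
  \det (\matrix_(i, j) ev i (q i)^`(delta n j)).

Definition delta_moment (a : multinom n) : K :=
  E (delta_det (fun i => 'X^(a i))).

Local Notation dhat := (mpoly_lin delta_moment).

(** Reversing the columns turns the orders delta into 0, 1, ..., n - 1. *)
Let delta_detE q : delta_det q =
  (-1) ^+ perm (@rev_ord_inj n) * deriv_det iota X0 q.
Proof.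
rewrite -det_perm mulrC -det_mulmx; congr (\det _).
apply/matrixP=> i j; rewrite !mxE (bigD1 (rev_ord j)) //= big1 => [|k kj].
  rewrite !mxE permE rev_ordK eqxx mulr1 addr0 mnmE /=.
  by rewrite -subn1 -subnDA add1n.
rewrite !mxE permE; case: eqP => [kE|_]; last by rewrite mulr0.
by rewrite -kE rev_ordK eqxx in kj.
Qed.

Let E_delta_det_shift z p :
  E (delta_det (fun i => ('X - z%:P) * p i)) =
  (\prod_i (b i - z)) * E (delta_det p).
Proof.
rewrite !delta_detE.
have sgn (s : 'S_n) F : E ((-1) ^+ s * F) = (-1) ^+ s * E F.
  by case: (odd_perm s); rewrite ?expr1 ?expr0 ?mulN1r ?mul1r ?raddfN.
by rewrite !sgn (E_deriv_det_shift DM DX Diota ED) Echi mulrCA.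
Qed.

Let dhat_prod (T : finType) (c : 'I_n -> T -> K) (r : 'I_n -> T -> nat) :
  dhat (\prod_i \sum_t c i t *: mpolyX K (mnm1 i) ^+ r i t) =
  E (delta_det (fun i => \sum_t c i t *: 'X^(r i t))).
Proof.
rewrite mpoly_lin_prod /delta_det.
have -> : \matrix_(i, j) ev i (\sum_t c i t *: 'X^(r i t))^`(delta n j) =
  \matrix_(i, j) \sum_t iota (c i t) * ev i ('X^(r i t))^`(delta n j).
  apply/matrixP=> i j; rewrite !mxE derivn_sumZ /ev_diag raddf_sum /=.
  rewrite horner_sum; apply: eq_bigr => t _.
  by rewrite map_polyZ hornerZ.
rewrite (det_multilinear _ (fun i t j => ev i ('X^(r i t))^`(delta n j))).
rewrite raddf_sum; apply: eq_bigr => e _ /=.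
rewrite -rmorph_prod Eiota; congr (_ * E (\det _)).
by apply/matrixP=> i j; rewrite !mxE mnmE.
Qed.

Let dhat_shift z g :
  dhat (\prod_i (mpolyX K (mnm1 i) - mpolyC n z) * g) =
  (\prod_i (b i - z)) * dhat g.
Proof.
rewrite [g]mpolyE mulr_sumr !raddf_sum /= mulr_sumr; apply: eq_bigr => m _.
rewrite -scalerAr !linearZ /= mulrCA; congr (_ * _).
rewrite mpoly_linX /delta_moment -E_delta_det_shift.
pose c (i : 'I_n) (t : bool) := if t then 1 else - z.
pose r (i : 'I_n) (t : bool) := if t then (m i).+1 else m i.
transitivity (dhat (\prod_i \sum_t c i t *: mpolyX K (mnm1 i) ^+ r i t)).
  congr (mpoly_lin _ _); rewrite [mpolyX K m]mpolyXE_id -big_split /=.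
  apply: eq_bigr => i _; rewrite big_bool /c /r /= scale1r scaleNr mulrBl.
  by rewrite exprS mul_mpolyC.
rewrite dhat_prod; congr (E (\det _)); apply/matrixP=> i j; rewrite !mxE.
by rewrite big_bool /c /r /= scale1r scaleNr mulrBl exprS mul_polyC.
Qed.

(** Both sides are coefficients of polynomials in z that agree at all natural
numbers, by [dhat_shift]. *)
Let dhat_mesym k g : (k <= n)%N ->
  dhat (mesym n K k * g) = meval b (mesym n K k) * dhat g.
Proof.
move=> le_kn; pose kk : 'I_n.+1 := Ordinal (le_kn : (k < n.+1)%N).
pose cs := [tuple mpolyX K (mnm1 i) | i < n].
pose bs := [tuple b i | i < n].
pose q := \prod_(c <- cs) ('X - c%:P).
pose qb := \prod_(c <- bs) ('X - c%:P).
have sq : size q = n.+1 by rewrite size_prod_XsubC size_tuple.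
have sqb : size qb = n.+1 by rewrite size_prod_XsubC size_tuple.
pose r := \poly_(l < n.+1) (dhat (q`_l * g) - qb`_l * dhat g).
have r0 : r = 0.
  apply: poly_eq0_nat => m; set z := m%:R; rewrite horner_poly.
  under eq_bigr do rewrite mulrBl mulrAC.
  rewrite sumrB -mulr_suml.
  have -> : \sum_(i < n.+1) qb`_i * z ^+ i = qb.[z].
    by rewrite horner_coef sqb.
  have -> : \sum_(i < n.+1) dhat (q`_i * g) * z ^+ i =
            dhat (q.[mpolyC n z] * g).
    rewrite horner_coef sq mulr_suml raddf_sum; apply: eq_bigr => i _ /=.
    have -> : q`_i * mpolyC n z ^+ i * g = (z ^+ i) *: (q`_i * g).
      by rewrite -mul_mpolyC rmorphXn /=; ring.
    by rewrite linearZ mulrC.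
  have -> : q.[mpolyC n z] =
      (-1) ^+ n *: \prod_i (mpolyX K (mnm1 i) - mpolyC n z).
    rewrite horner_prod big_tuple.
    under [in LHS]eq_bigr do rewrite hornerXsubC tnth_mktuple.
    by rewrite prod_subC -mul_mpolyC rmorphXn rmorphN1.
  have -> : qb.[z] = (-1) ^+ n * \prod_i (b i - z).
    rewrite horner_prod big_tuple.
    under [in LHS]eq_bigr do rewrite hornerXsubC tnth_mktuple.
    by rewrite prod_subC.
  by rewrite -scalerAl linearZ /= dhat_shift mulrA subrr.
have := congr1 (fun p : {poly K} => p`_(n - k)) r0.
rewrite coef_poly coef0 ltnS leq_subr => /eqP; rewrite subr_eq0 => /eqP.
rewrite (mroots_coeff cs kk) (mroots_coeff bs kk) /=.
rewrite (meval_eq _ (tnth_mktuple _)) mesym_variables.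
rewrite (meval_eq _ (tnth_mktuple _)).
have -> : (-1) ^+ k * mesym n K k * g = (-1) ^+ k *: (mesym n K k * g).
  by rewrite -mulrA -mul_mpolyC rmorphXn rmorphN1.
rewrite linearZ /= -mulrA; apply: mulfI.
by rewrite expf_neq0 // oppr_eq0 oner_neq0.
Qed.

(** Elementary symmetric polynomials generate all symmetric ones. *)
Lemma delta_moment_symmetric p g : p \is symmetric ->
  mpoly_lin delta_moment (p * g) = meval b p * mpoly_lin delta_moment g.
Proof.
move/symfP=> ->; set t := symf p.
pose good q := forall g, dhat (q * g) = meval b q * dhat g.
suff : good (comp_mpoly [tuple mesym n K i.+1 | i < n] t) by apply.
have good1 : good 1 by move=> h; rewrite meval1 !mul1r.
have goodM q1 q2 : good q1 -> good q2 -> good (q1 * q2).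
  by move=> h1 h2 h; rewrite -mulrA h1 h2 mevalM mulrA.
rewrite comp_mpolyEX => h; rewrite mulr_suml !raddf_sum /= mulr_suml.
apply: eq_bigr => m _; rewrite -scalerAl linearZ /= mevalZ -mulrA.
congr (_ * _); move: h; rewrite -/(good _) comp_mpolyX.
elim/big_ind: _ => // i _.
elim: (m i) => [|l IH]; first by rewrite expr0.
rewrite exprS; apply: goodM => //.
by rewrite tnth_mktuple => h; apply: dhat_mesym.
Qed.

End SymmetricMultiplication.

(** * Alternants *)

Local Notation mperm m s := (Multinom [tuple (m : multinom _) (s i) | i < _]).

Section Alternants.
Variables (K : comNzRingType) (n : nat).
Implicit Types (m mu : multinom n) (p : mpoly n K).

(** The polynomial [alternant], over an arbitrary commutative ring. *)
Definition alt_poly mu : mpoly n K :=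
  \det (\matrix_(i < n, j < n) mpolyX K (mnm1 i) ^+ mu j).

Lemma alt_polyE mu :
  alt_poly mu = \sum_(s : 'S_n) (-1) ^+ s *: mpolyX K (mperm mu s).
Proof.
apply: eq_bigr => s _.
rewrite -mul_mpolyC rmorphXn rmorphN1; congr (_ * _).
rewrite mpolyXE_id; apply: eq_bigr => i _; rewrite mxE mnmE; congr (_ ^+ _).
Qed.

Lemma msym_alt_poly mu (s : 'S_n) :
  msym s (alt_poly mu) = (-1) ^+ s *: alt_poly mu.
Proof.
rewrite alt_polyE raddf_sum scaler_sumr (reindex_inj (mulgI s)).
apply: eq_bigr => t _ /=; rewrite linearZ /= scalerA msymX odd_permM signr_addb.
congr (_ *: mpolyX _ _); apply/mnmP=> i; rewrite !mnmE permM.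
by rewrite permKV.
Qed.

Lemma mcoeffMX_le m p a :
  mcoeff a (p * mpolyX K m) =
  if [forall i, (m i <= a i)%N] then mcoeff (mnm_sub a m) p else 0.
Proof.
case: ifP => [/forallP ma|ma].
  have {1}-> : a = mnm_add m (mnm_sub a m).
    by apply/mnmP=> i; rewrite mnmDE mnmBE subnKC.
  by rewrite mcoeffMX.
apply: memN_msupp_eq0; apply: contraFN ma; rewrite (perm_mem (msuppMX _ _)).
by case/mapP=> k _ -> ; apply/forallP=> i; rewrite mnmDE leq_addr.
Qed.

Lemma mcoeff_alt_polyM mu p a :
  mcoeff a (alt_poly mu * p) =
  \sum_(s : 'S_n) (-1) ^+ s *
    (if [forall i, (mu (s i) <= a i)%N]
     then mcoeff (mnm_sub a (mperm mu s)) p else 0).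
Proof.
rewrite alt_polyE mulr_suml raddf_sum; apply: eq_bigr => s _ /=.
rewrite -scalerAl mcoeffZ [mpolyX _ _ * p]mulrC mcoeffMX_le; congr (_ * _).
by congr (if _ then _ else _); apply: eq_forallb => i; rewrite mnmE.
Qed.

End Alternants.

Definition is_partition n (lam : multinom n) : bool :=
  [forall i : 'I_n, forall j : 'I_n, (i <= j)%N ==> (lam j <= lam i)%N].

Lemma is_partitionP n (lam : multinom n) :
  reflect (forall i j : 'I_n, (i <= j)%N -> (lam j <= lam i)%N)
          (is_partition lam).
Proof.
apply: (iffP forallP) => H i.
  by move=> j ij; have /forallP/(_ j)/implyP := H i; apply.
by apply/forallP=> j; apply/implyP; apply: H.
Qed.

Lemma delta_lt n (i j : 'I_n) : (i < j)%N -> (delta n j < delta n i)%N.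
Proof.
move=> ij; rewrite !mnmE; have := ltn_ord j; case: n i j ij => [[]//|n] i j ij.
by rewrite ltnS => jn; rewrite ltn_sub2l // (leq_trans ij).
Qed.

Lemma partition_delta_lt n (lam : multinom n) (i j : 'I_n) :
  is_partition lam -> (i < j)%N ->
  (mnm_add lam (delta n) j < mnm_add lam (delta n) i)%N.
Proof.
move/is_partitionP => P ij; rewrite !mnmDE -addnS leq_add ?delta_lt //.
by apply: P; apply: ltnW.
Qed.

Lemma partition0 n : is_partition (@mnm0 n).
Proof. by apply/is_partitionP=> i j _; rewrite !mnm0E. Qed.

Lemma perm_first_moved n (s : 'S_n) : s != 1%g ->
  exists i : 'I_n, (i < s i)%N /\ forall j : 'I_n, (j < i)%N -> s j = j.
Proof.
move=> s1; have /existsP[i0 si0] : [exists i, s i != i].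
  apply: contraNT s1; rewrite negb_exists => /forallP H.
  by apply/eqP/permP=> i; rewrite perm1; apply/eqP; rewrite -[_ == _]negbK H.
case: (@arg_minnP _ i0 (fun i => s i != i) (@nat_of_ord n) si0) => i si min.
exists i; have fix_lt (j : 'I_n) : (j < i)%N -> s j = j.
  by move=> ji; apply/eqP; apply: contraLR ji => /min; rewrite -leqNgt.
split=> //; rewrite ltn_neqAle eq_sym si leqNgt; apply/negP => /fix_lt /perm_inj.
by apply/eqP.
Qed.

(** At the first moved position a strictly decreasing exponent gets smaller.
*)
Lemma strict_perm_le n (a : multinom n) (s : 'S_n) :
  (forall i j : 'I_n, (i < j)%N -> (a j < a i)%N) ->
  s != 1%g -> (mperm a s < a)%O.
Proof.
move=> adec /perm_first_moved [i [si fix_lt]].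
apply/ltmcP; first exact: mdeg_mperm.
exists i => [j ji|]; rewrite mnmE; first by rewrite fix_lt.
exact: adec.
Qed.

Section AlternantCoefficients.
Variables (K : comNzRingType) (n : nat).

(** A strictly decreasing exponent is the largest one in its orbit, so that
two of them are conjugate only if they are equal. *)
Lemma mcoeff_alt_partition (lam mu : multinom n) :
  is_partition lam -> is_partition mu ->
  mcoeff (mnm_add mu (delta n)) (alt_poly K (mnm_add lam (delta n))) =
  (lam == mu)%:R.
Proof.
move=> Plam Pmu; rewrite alt_polyE raddf_sum /= (bigD1 1%g) //=.
rewrite odd_perm1 expr0 scale1r mcoeffX mperm1 eqm_add2r big1 ?addr0 // => s s1.
rewrite mcoeffZ mcoeffX; case: eqP => [E|_]; last by rewrite mulr0.
have := strict_perm_le (fun i j => @partition_delta_lt _ mu i j Pmu).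
move=> /(_ s^-1%g); rewrite -E mpermKV => H.
have := strict_perm_le (fun i j => @partition_delta_lt _ lam i j Plam) s1.
move=> H'; have s1' : s^-1%g != 1%g by rewrite eq_invg_sym invg1.
by have := lt_trans H' (H s1'); rewrite ltxx.
Qed.

Lemma mleadc_alt_delta :
  mlead (alt_poly K (delta n)) = delta n /\
  mcoeff (delta n) (alt_poly K (delta n)) = 1.
Proof.
have c1 : mcoeff (delta n) (alt_poly K (delta n)) = 1.
  have := mcoeff_alt_partition (partition0 n) (partition0 n).
  by rewrite add0m eqxx.
split=> //; apply/eqP; rewrite eq_le; apply/andP; split; last first.
  apply: msupp_le_mlead; rewrite mcoeff_msupp c1; exact: oner_neq0.
rewrite alt_polyE; apply: le_trans (mlead_sum_le _ _ _) _.
apply/joinsP => s _; apply: le_trans (mleadZ_le _ _) _; rewrite mleadXm.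
case: (eqVneq s 1%g) => [->|s1]; first by rewrite mperm1.
by apply/ltW/strict_perm_le => // i j; apply: delta_lt.
Qed.

End AlternantCoefficients.

(** * From alternating moments to moments *)

Section MomentInversion.
Variables (K : numFieldType) (n : nat).
Variables (L : multinom n -> K) (b : 'I_n -> K).
Variable S : multinom n -> mpoly n K.
Local Notation delta := (delta n).
Local Notation alt := (alt_poly K).

Definition alt_moment (a : multinom n) : K :=
  \sum_(s : 'S_n) (-1) ^+ s *
    ((\prod_i ((a i) ^_ (delta (s i)))%N)%:R * L (mnm_sub a (mperm delta s))).

Hypothesis Lsym : forall a (s : 'S_n), L (mperm a s) = L a.
Hypothesis L0 : L (@mnm0 n) = 1.
Hypothesis Lmul : forall p g, p \is symmetric ->
  mpoly_lin alt_moment (p * g) = meval b p * mpoly_lin alt_moment g.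
Hypothesis SE : forall lam, is_partition lam ->
  S lam * alt delta = alt (mnm_add lam delta).

Lemma mfact_neq0 (a : multinom n) : (mfact a)%:R != 0 :> K.
Proof. by rewrite pnatr_eq0 -lt0n prodn_gt0 // => i; rewrite fact_gt0. Qed.

Lemma mfact_mperm (a : multinom n) (s : 'S_n) : mfact (mperm a s) = mfact a.
Proof.
rewrite /mfact [RHS](reindex_inj (@perm_inj _ s)).
by apply: eq_bigr => i _; rewrite mnmE.
Qed.

(** The homogeneous component of degree k of the exponential generating
function of L. *)
Definition moment_poly k : mpoly n K :=
  \sum_(m : bmultinom n k.+1)
    (if mdeg m == k then L m / (mfact m)%:R else 0) *: mpolyX K m.

Lemma mcoeff_moment_poly k a :
  mcoeff a (moment_poly k) = if mdeg a == k then L a / (mfact a)%:R else 0.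
Proof.
case: (ltnP (mdeg a) k.+1) => ak.
  exact: (mcoeff_mpoly (fun m => if mdeg m == k then L m / (mfact m)%:R else 0)).
rewrite gtn_eqF // raddf_sum big1 // => m _ /=.
rewrite mcoeffZ mcoeffX; case: (eqVneq (m : multinom n) a) => [E|_].
  by have := bmdeg m; rewrite E ltnNge ak.
by rewrite mulr0.
Qed.

Lemma moment_poly_sym k : moment_poly k \is symmetric.
Proof.
apply/issymP=> s; apply/mpolyP=> a.
by rewrite mcoeff_sym !mcoeff_moment_poly mdeg_mperm Lsym mfact_mperm.
Qed.

Lemma mcoeff_alt_moment_poly k a : mdeg a = (k + mdeg delta)%N ->
  (mfact a)%:R * mcoeff a (alt delta * moment_poly k) = alt_moment a.
Proof.
move=> da; rewrite mcoeff_alt_polyM mulr_sumr; apply: eq_bigr => s _.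
rewrite mulrCA; congr (_ * _); case: ifP => [/forallP le_a|/negbT].
  have Ea : mnm_add (mnm_sub a (mperm delta s)) (mperm delta s) = a.
    by apply/mnmP=> i; rewrite mnmDE mnmBE mnmE subnK.
  rewrite mcoeff_moment_poly.
  have -> : mdeg (mnm_sub a (mperm delta s)) == k.
    by have := congr1 (@mdeg n) Ea; rewrite mdegD mdeg_mperm da => /addIn ->.
  set c := mnm_sub _ _; rewrite mulrCA mulrC; congr (_ * _).
  apply: canLR (mulfK (mfact_neq0 c)) _; rewrite -natrM; congr _%:R.
  rewrite /mfact -big_split; apply: eq_bigr => i _ /=.
  by rewrite mnmBE mnmE ffact_fact.
move=> /forallPn[j]; rewrite -ltnNge => lt_a.
by rewrite mulr0 (bigD1 j) //= ffact_small // mul0n mul0r.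
Qed.

Lemma alt_moment_perm a (s : 'S_n) :
  (mdeg delta <= mdeg a)%N ->
  alt_moment (mperm a s) = (-1) ^+ s * alt_moment a.
Proof.
move=> le_a; pose k := (mdeg a - mdeg delta)%N.
have da : mdeg a = (k + mdeg delta)%N by rewrite subnK.
rewrite -!(@mcoeff_alt_moment_poly k) ?mdeg_mperm // mfact_mperm mulrCA.
congr (_ * _); rewrite -mcoeff_sym msymM msym_alt_poly.
have /issymP -> := moment_poly_sym k.
by rewrite -scalerAl mcoeffZ.
Qed.

(** All n! terms of the alternant contribute equally, since the moments are
alternating themselves.  The degree condition comes from reading them off from
the polynomial [moment_poly]. *)
Lemma alt_moment_alt mu : (mdeg delta <= mdeg mu)%N ->
  mpoly_lin alt_moment (alt mu) = (n`!)%:R * alt_moment mu.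
Proof.
move=> le_mu; rewrite alt_polyE raddf_sum /=.
transitivity (\sum_(s : 'S_n) alt_moment mu).
  apply: eq_bigr => s _; rewrite linearZ /= mpoly_linX alt_moment_perm //.
  by rewrite mulrA -expr2 -exprM mulnC exprM sqrrN !expr1n mul1r.
by rewrite sumr_const -card_Sn mulr_natl.
Qed.

Lemma alt_delta_neq0 : alt delta != 0.
Proof.
apply/eqP => E; have [_] := mleadc_alt_delta K n.
by rewrite E mcoeff0 => /esym/eqP; rewrite oner_eq0.
Qed.

Lemma S_sym lam : is_partition lam -> S lam \is symmetric.
Proof.
move=> Plam; apply/issymP=> s; apply: (mulIf alt_delta_neq0).
rewrite SE //.
have := congr1 (msym s) (SE Plam); rewrite msymM !msym_alt_poly.
rewrite -scalerAr => /(congr1 (fun p => (-1) ^+ s *: p)).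
by rewrite !scalerA -signr_addb addbb expr0 !scale1r.
Qed.

Lemma alt_moment_delta : alt_moment delta = (mfact delta)%:R.
Proof.
rewrite -(@mcoeff_alt_moment_poly 0) //.
have -> : moment_poly 0 = 1.
  apply/mpolyP=> a; rewrite mcoeff_moment_poly mcoeff1 mdeg_eq0.
  case: eqP => // ->; rewrite L0 /mfact big1 ?divr1 // => i _.
  by rewrite mnm0E.
by rewrite mulr1 (mleadc_alt_delta K n).2 mulr1.
Qed.

(** The alternant of lam + delta is S lam times that of delta. So the
functional sends it both to n! times the left-hand side and to S lam (b) times
its value n! delta! at delta. *)
Lemma alt_moment_partition lam : is_partition lam ->
  alt_moment (mnm_add lam delta) = (mfact delta)%:R * meval b (S lam).
Proof.
move=> Plam; have nf : (n`!)%:R != 0 :> K by rewrite pnatr_eq0 -lt0n fact_gt0.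
apply: (mulfI nf); rewrite -alt_moment_alt ?mdegD ?leq_addl // -SE //.
rewrite Lmul ?S_sym // alt_moment_alt // alt_moment_delta.
by rewrite mulrCA [meval _ _ * _]mulrC.
Qed.

(** The difference h of the two sides is symmetric, so if it is not zero its
leading exponent mu is a partition, and a_delta h has a nonzero coefficient at
mu + delta. But there the coefficients of a_delta times either side are known,
and they agree. *)
Lemma moment_poly_schur k :
  moment_poly k =
  \sum_(lam : bmultinom n k.+1 | is_partition lam && (mdeg lam == k))
    ((mfact delta)%:R / (mfact (mnm_add lam delta))%:R * meval b (S lam))
      *: S lam.
Proof.
apply/eqP; rewrite -subr_eq0; set h := _ - _.
have hE : alt delta * h = alt delta * moment_poly k -
  \sum_(lam : bmultinom n k.+1 | is_partition lam && (mdeg lam == k))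
    ((mfact delta)%:R / (mfact (mnm_add lam delta))%:R * meval b (S lam))
      *: alt (mnm_add lam delta).
  rewrite /h mulrBr; congr (_ - _); rewrite mulr_sumr.
  by apply: eq_bigr => lam /andP[Plam _]; rewrite -scalerAr [alt _ * _]mulrC SE.
have hsym : h \is symmetric.
  rewrite rpredB ?moment_poly_sym // rpred_sum // => lam /andP[Plam _].
  by rewrite rpredZ // S_sym.
apply: contraT => nz_h; set mu := mlead h.
have Pmu : is_partition mu by apply/is_partitionP; apply: mlead_msym_sorted.
have nz_c : mcoeff (mnm_add delta mu) (alt delta * h) != 0.
  have -> : mnm_add delta mu = mnm_add (mlead (alt delta)) (mlead h).
    by rewrite (mleadc_alt_delta K n).1.
  by rewrite mleadcM (mleadc_alt_delta K n).1 (mleadc_alt_delta K n).2 mul1r mleadc_eq0.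
move: nz_c; rewrite addmC hE mcoeffB.
rewrite raddf_sum /=.
have -> : \sum_(lam : bmultinom n k.+1 | is_partition lam && (mdeg lam == k))
    mcoeff (mnm_add mu delta) (((mfact delta)%:R / (mfact (mnm_add lam delta))%:R
       * meval b (S lam)) *: alt (mnm_add lam delta)) =
  if mdeg mu == k then alt_moment (mnm_add mu delta)
      / (mfact (mnm_add mu delta))%:R else 0.
  case: ifP => [/eqP dmu|dmu].
    have lt_mu : (mdeg mu < k.+1)%N by rewrite dmu.
    rewrite (bigD1 (BMultinom lt_mu)) /=; last by rewrite Pmu dmu eqxx.
    rewrite mcoeffZ mcoeff_alt_partition // eqxx mulr1 big1 => [|lam].
      by rewrite addr0 alt_moment_partition // mulrAC.
    case/andP=> /andP[Plam _] ne; rewrite mcoeffZ mcoeff_alt_partition //.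
    case: eqP => [E|_]; last by rewrite mulr0.
    by case/eqP: ne; apply: val_inj.
  apply: big1 => lam /andP[Plam /eqP dlam].
  rewrite mcoeffZ mcoeff_alt_partition //.
  case: eqP => [E|_]; last by rewrite mulr0.
  by rewrite -E dlam eqxx in dmu.
case: ifP => [/eqP dmu|dmu].
  rewrite -(@mcoeff_alt_moment_poly k) ?mdegD ?dmu //.
  by rewrite mulrAC divff ?mfact_neq0 // mul1r subrr eqxx.
(* in degrees other than k all coefficients vanish *)
rewrite subr0 mcoeff_alt_polyM big1 ?eqxx // => s _.
case: ifP => [/forallP le_a|_]; last by rewrite mulr0.
rewrite mcoeff_moment_poly; case: eqP => [E|_]; last by rewrite mulr0.
have Ea : mnm_add (mnm_sub (mnm_add mu delta) (mperm delta s)) (mperm delta s)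
          = mnm_add mu delta.
  by apply/mnmP=> i; rewrite mnmDE mnmBE mnmE subnK.
have := congr1 (@mdeg n) Ea; rewrite !mdegD mdeg_mperm E => /addIn Ek.
by rewrite Ek eqxx in dmu.
Qed.

Theorem moment_expansion eta :
  L eta = \sum_(lam : bmultinom n (mdeg eta).+1 |
                is_partition lam && (mdeg lam == mdeg eta))
    ((mfact delta)%:R * (mfact eta)%:R) / (mfact (mnm_add lam delta))%:R
      * mcoeff eta (S lam) * meval b (S lam).
Proof.
have := congr1 (mcoeff eta) (moment_poly_schur (mdeg eta)).
rewrite mcoeff_moment_poly eqxx raddf_sum /= => H.
rewrite -[LHS](mulfVK (mfact_neq0 eta)) H mulr_suml.
apply: eq_bigr => lam _; rewrite mcoeffZ; ring.
Qed.

End MomentInversion.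

(** * The tableau formula for Schur polynomials *)

Section BialternantBranching.
Variables (A : comNzRingType) (x : nat -> A).

(** The determinant in k variables with exponents l j + (k - 1 - j); l is a
function on all natural numbers so that k can vary. *)
Definition bialternant k (l : nat -> nat) : A :=
  \det (\matrix_(i < k, j < k) x i ^+ (l j + (k.-1 - j))).

Definition interlaces k M (l : nat -> nat) (e : {ffun 'I_k -> 'I_M}) : bool :=
  [forall j : 'I_k, (l j.+1 <= e j <= l j)%N].

Lemma det_scale_rows k (r : 'I_k -> A) (G : 'M[A]_k) :
  \det (\matrix_(i, j) (r i * G i j)) = \prod_i r i * \det G.
Proof.
rewrite /determinant mulr_sumr; apply: eq_bigr => s _.
rewrite mulrCA -big_split; congr (_ * _).
by apply: eq_bigr => i _; rewrite mxE.
Qed.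

(** The quotient of a difference of powers, with the geometric sum written as
a sum over the interval from q to p inside the range below M. *)
Lemma subr_expX_interval (a t : A) (p q c M : nat) : (q <= p < M)%N ->
  a ^+ (p + c.+1) - t ^+ (p - q).+1 * a ^+ (q + c) =
  (a - t) * \sum_(m < M) (if (q <= m <= p)%N then t ^+ (p - m) else 0)
                          * a ^+ (m + c).
Proof.
case/andP=> qp pM; set d := (p - q)%N.
have -> : \sum_(m < M) (if (q <= m <= p)%N then t ^+ (p - m) else 0)
              * a ^+ (m + c) = (\sum_(r < d.+1) a ^+ (d - r) * t ^+ r) * a ^+ (q + c).
  rewrite -(big_mkord xpredT (fun m =>
     (if (q <= m <= p)%N then t ^+ (p - m) else 0) * a ^+ (m + c))).
  rewrite (big_cat_nat (n := q)) //=; last by rewrite (leq_trans qp) // ltnW.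
  rewrite big_nat_cond big1 ?add0r; last first.
    by move=> m /andP[/andP[_ mq] _]; rewrite leqNgt mq mul0r.
  rewrite (big_cat_nat (n := p.+1)) //=; last by rewrite leqW.
  rewrite [X in _ + X]big_nat_cond [X in _ + X]big1 ?addr0; last first.
    by move=> m /andP[/andP[pm _] _]; rewrite [(m <= p)%N]leqNgt pm andbF mul0r.
  rewrite -{1}[q]add0n big_addn subSn // -/d big_mkord mulr_suml.
  rewrite (reindex_inj rev_ord_inj); apply: eq_bigr => r _ /=.
  have rd : (r <= d)%N by rewrite -ltnS.
  rewrite subSS.
  have -> : (q <= d - r + q <= p)%N.
    by rewrite leq_addl -(subnK qp) leq_add2r leq_subr.
  have -> : (p - (d - r + q) = r)%N by rewrite subnDAC -/d subKn.
  by rewrite -addnA exprD mulrA [t ^+ r * _]mulrC.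
rewrite mulrA -subrXX mulrBl; congr (_ - _).
have -> : (p + c.+1 = d.+1 + (q + c))%N by rewrite /d addSn addnA subnK // addnS.
by rewrite exprD.
Qed.

(** Subtracting from each column a multiple of the next one, by powers of t =
x k, clears the last row except for its last entry. The remaining minor has
the factors x i - t in its rows and geometric sums in its columns; expanding
these sums by multilinearity gives the interlacing exponents e. *)
Lemma bialternant_branching k M (l : nat -> nat) :
  (forall j, l j.+1 <= l j)%N -> (forall j, l j < M)%N ->
  bialternant k.+1 l = \prod_(i < k) (x i - x k) *
    \sum_(e : {ffun 'I_k -> 'I_M} | interlaces l e)
       x k ^+ (l k + \sum_(j < k) (l j - e j)) *
       bialternant k (fun j => if insub j is Some j' then e j' : nat else 0%N).
Proof.
move=> ldec lM; set t := x k.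
have predB (m j : nat) : (m.-1 - j = m - j.+1)%N.
  by rewrite -subn1 -subnDA add1n.
pose al (j : nat) := (l j + (k - j))%N.
pose U : 'M[A]_k.+1 := \matrix_(i, j)
  (if i == j then 1 else if i == j.+1 :> nat then - t ^+ (l j - l j.+1).+1 else 0).
have detU : \det U = 1.
  rewrite det_trig; last first.
    apply/is_trig_mxP => i j ij; rewrite mxE -val_eqE (ltn_eqF ij).
    by rewrite (ltn_eqF (leqW ij)).
  by rewrite big1 // => i _; rewrite mxE eqxx.
pose G : 'M[A]_k.+1 := \matrix_(i, j) x i ^+ (l j + (k - j)).
have GU i j : (G *m U) i j = x i ^+ al j -
   (if (j < k)%N then t ^+ (l j - l j.+1).+1 * x i ^+ al j.+1 else 0).
  rewrite mxE (bigD1 j) //= !mxE eqxx mulr1; congr (_ + _).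
  case: ltnP => jk.
    have jk1 : (j.+1 < k.+1)%N by [].
    rewrite (bigD1 (Ordinal jk1)) /=; last by rewrite -val_eqE /= gtn_eqF.
    rewrite !mxE -val_eqE /= gtn_eqF // eqxx mulrN mulrC big1 ?addr0 //.
    move=> i' /andP[/negPf i'j i'j1]; rewrite !mxE i'j.
    by move: i'j1; rewrite -val_eqE /= => /negPf ->; rewrite mulr0.
  rewrite oppr0 big1 // => i' /negPf i'j; rewrite !mxE i'j.
  case: eqP => [E|_]; last by rewrite mulr0.
  by have := ltn_ord i'; rewrite E ltnS ltnNge jk.
have -> : bialternant k.+1 l = \det (G *m U) by rewrite det_mulmx detU mulr1.
rewrite (expand_det_row _ ord_max) big_ord_recr big1 ?add0r /=; last first.
  move=> j _; rewrite GU /= ltn_ord.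
  have -> : al j = ((l j - l j.+1).+1 + al j.+1)%N.
    rewrite /al addnA addSn subnK // addSn -addnS; congr (_ + _)%N.
    by rewrite -subSn ?ltn_ord.
  by rewrite exprD -/t subrr mul0r.
rewrite GU /= ltnn subr0 /al subnn addn0 /cofactor -signr_odd addnn odd_double.
rewrite mul1r -/t.
pose H : 'M[A]_k := \matrix_(i, j) \sum_(m < M)
  (if (l j.+1 <= m <= l j)%N then t ^+ (l j - m) else 0) * x i ^+ (m + (k.-1 - j)).
have -> : row' ord_max (col' ord_max (G *m U)) =
    \matrix_(i, j) ((x i - t) * H i j).
  apply/matrixP=> i j.
  transitivity ((G *m U) (lift ord_max i) (lift ord_max j)).
    by rewrite !mxE.
  have E (a : 'I_k) : nat_of_ord (lift ord_max a) = a.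
    by rewrite /= /bump leqNgt ltn_ord.
  rewrite GU !E ltn_ord !mxE -subr_expX_interval ?ldec ?lM // /al.
  have -> : (k.-1 - j).+1 = (k - j)%N.
    by rewrite predB subnSK // ltn_ord.
  by rewrite predB.
rewrite det_scale_rows add0r mulrCA; congr (_ * _).
rewrite -det_tr.
have -> : H^T = \matrix_(j, i) \sum_(m : 'I_M)
  (if (l j.+1 <= m <= l j)%N then t ^+ (l j - m) else 0) * x i ^+ (m + (k.-1 - j)).
  by apply/matrixP=> j i; rewrite !mxE.
rewrite (det_multilinear (fun (j : 'I_k) (m : 'I_M) =>
    if (l j.+1 <= m <= l j)%N then t ^+ (l j - m) else 0)
  (fun (j : 'I_k) (m : 'I_M) (i : 'I_k) => x i ^+ (m + (k.-1 - j)))).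
rewrite mulr_sumr [RHS]big_mkcond; apply: eq_bigr => e _ /=.
case: ifP => [/forallP He|/negbT].
  rewrite exprD mulrA; congr (_ * _ * _).
    rewrite -prodrXr; apply: eq_bigr => j _.
    by rewrite He.
  rewrite -det_tr; congr (\det _); apply/matrixP=> i j; rewrite !mxE.
  by rewrite valK.
move=> /forallPn[j /negPf Hj].
by rewrite (bigD1 j) //= Hj !mul0r mulr0.
Qed.

End BialternantBranching.

Section Reading.
Variables (n k : nat) (lt_kn : (k < n)%N).
Implicit Types lam mu : multinom n.
Let kk : 'I_n := Ordinal lt_kn.

(** Reading with a plain column number and the default value k outside the
diagram allows a tableau to be compared with its restriction to a smaller
shape: where the smaller diagram ends, the larger one is filled with k. *)
Definition entry lam (T : {ffun cell lam -> 'I_n}) (i : 'I_n) (j : nat) : 'I_n :=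
  if (insub j : option 'I_(lam i)) is Some j'
  then T (Tagged (fun i => 'I_(lam i)) j') else kk.

Lemma entry_tagged lam (T : {ffun cell lam -> 'I_n}) (c : cell lam) :
  entry T (tag c) (tagged c) = T c.
Proof. by case: c => i j; rewrite /entry /= valK. Qed.

Lemma entry_out lam (T : {ffun cell lam -> 'I_n}) (i : 'I_n) j :
  (lam i <= j)%N -> entry T i j = kk.
Proof. by move=> ij; rewrite /entry insubF // ltnNge ij. Qed.

Lemma entry_finfun lam (f : 'I_n -> nat -> 'I_n) i j : (j < lam i)%N ->
  entry [ffun c : cell lam => f (tag c) (tagged c)] i j = f i j.
Proof. by move=> ij; rewrite /entry insubT ffunE. Qed.

Lemma entry_inj lam (T1 T2 : {ffun cell lam -> 'I_n}) :
  (forall i j, (j < lam i)%N -> entry T1 i j = entry T2 i j) -> T1 = T2.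
Proof.
by move=> H; apply/ffunP=> c; rewrite -!entry_tagged H.
Qed.

Lemma ssyt_entryP lam (T : {ffun cell lam -> 'I_n}) :
  reflect ((forall (i : 'I_n) j j', (j <= j')%N -> (j' < lam i)%N ->
              (entry T i j <= entry T i j')%N) /\
           (forall (i i' : 'I_n) j, (i < i')%N -> (j < lam i)%N -> (j < lam i')%N ->
              (entry T i j < entry T i' j)%N))
          (is_ssyt T).
Proof.
apply: (iffP forallP) => [H|[Hr Hc] c]; last first.
  apply/forallP=> c'; apply/andP; split; apply/implyP.
    case: c c' => [i j] [i' j'] /= /andP[/eqP E jj']; subst i'.
    have := Hr i j j' jj' (ltn_ord j').
    by rewrite -[X in (X <= _)%N -> _]/(val _) /entry !valK.
  case: c c' => [i j] [i' j'] /= /andP[ii' /eqP jj'].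
  have ji' : (j < lam i')%N by rewrite jj'.
  have := Hc i i' j ii' (ltn_ord j) ji'.
  have -> : entry T i' j = T (Tagged (fun i => 'I_(lam i)) j').
    by rewrite jj' /entry valK.
  by rewrite /entry valK.
split=> [i j j' jj' j'i | i i' j ii' ji ji'].
  have ji : (j < lam i)%N by apply: leq_ltn_trans j'i.
  pose c : cell lam := Tagged (fun i => 'I_(lam i)) (Ordinal ji).
  pose c' : cell lam := Tagged (fun i => 'I_(lam i)) (Ordinal j'i).
  have /forallP/(_ c')/andP[/implyP] := H c.
  by rewrite /= eqxx jj' /entry !insubT => /(_ isT).
pose c : cell lam := Tagged (fun i => 'I_(lam i)) (Ordinal ji).
pose c' : cell lam := Tagged (fun i => 'I_(lam i)) (Ordinal ji').
have /forallP/(_ c')/andP[_ /implyP] := H c.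
by rewrite /= eqxx ii' /entry !insubT => /(_ isT).
Qed.

Lemma entries_ltP lam (T : {ffun cell lam -> 'I_n}) m :
  reflect (forall i j, (j < lam i)%N -> (entry T i j < m)%N)
          [forall c, (T c < m)%N].
Proof.
apply: (iffP forallP) => H; last by move=> c; rewrite -entry_tagged H.
by move=> i j ij; rewrite /entry insubT.
Qed.

Lemma ssyt_entry_ge lam (T : {ffun cell lam -> 'I_n}) (i : 'I_n) j :
  is_partition lam -> is_ssyt T -> (j < lam i)%N -> (i <= entry T i j)%N.
Proof.
move=> /is_partitionP Plam /ssyt_entryP[_ Hc].
case: i => [i lt_in]; elim: i lt_in => // i IH lt_in ji.
have lt_in' : (i < n)%N by apply: ltnW.
have ji' : (j < lam (Ordinal lt_in'))%N.
  by apply: leq_trans ji _; apply: Plam => /=.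
apply: leq_ltn_trans (IH lt_in' ji') _; exact: Hc.
Qed.

Lemma prod_entries lam (A : comNzRingType) (x : nat -> A)
    (T : {ffun cell lam -> 'I_n}) :
  \prod_c x (T c) = \prod_i \prod_(0 <= j < lam i) x (entry T i j).
Proof.
transitivity (\prod_(c : cell lam) x (entry T (tag c) (tagged c))).
  by apply: eq_bigr => c _; rewrite entry_tagged.
rewrite -(sig_big_dep xpredT (fun i (_ : 'I_(lam i)) => true)
           (fun i (j : 'I_(lam i)) => x (entry T i j))) /=.
by apply: eq_bigr => i _; rewrite big_mkord.
Qed.

(** The position where the entries below k end, rows being weakly increasing.
*)
Definition row_cut lam (T : {ffun cell lam -> 'I_n}) i : nat :=
  find (fun j => (k <= entry T i j)%N) (iota 0 (lam i)).

Lemma row_cut_le lam (T : {ffun cell lam -> 'I_n}) i : (row_cut T i <= lam i)%N.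
Proof. by rewrite -[X in (_ <= X)%N](size_iota 0) find_size. Qed.

Lemma entry_lt_cut lam (T : {ffun cell lam -> 'I_n}) (i : 'I_n) j :
  is_ssyt T -> (j < lam i)%N -> (entry T i j < k)%N = (j < row_cut T i)%N.
Proof.
move=> /ssyt_entryP[Hr _] ji; apply/idP/idP; last first.
  move=> jc; have := before_find 0%N jc.
  by rewrite nth_iota // add0n ltnNge => ->.
apply: contraLR; rewrite -!leqNgt => cj.
have ci : (row_cut T i < lam i)%N by apply: leq_ltn_trans ji.
have hs : has (fun j => (k <= entry T i j)%N) (iota 0 (lam i)).
  by rewrite has_find size_iota.
have := nth_find 0%N hs; rewrite -/(row_cut T i) nth_iota // add0n.
by move/leq_trans; apply; apply: Hr.
Qed.

Lemma row_cut_eq lam (T : {ffun cell lam -> 'I_n}) (i : 'I_n) m :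
  is_ssyt T -> (m <= lam i)%N ->
  (forall j, (j < lam i)%N -> (entry T i j < k)%N = (j < m)%N) ->
  row_cut T i = m.
Proof.
move=> ssT mi H; apply/eqP; rewrite eqn_leq; apply/andP; split.
  rewrite leqNgt; apply/negP => mc.
  have ml : (m < lam i)%N by apply: leq_trans mc (row_cut_le T i).
  by have := entry_lt_cut ssT ml; rewrite H // mc ltnn.
rewrite leqNgt; apply/negP => cm.
have cl : (row_cut T i < lam i)%N by apply: leq_trans mi.
by have := entry_lt_cut ssT cl; rewrite H // cm ltnn.
Qed.

End Reading.

(** Schur polynomial in the first k of n variables; the length n of the
exponent stays fixed while k varies in the recursion. *)
Definition ssyt_sum (A : comNzRingType) (x : nat -> A) n k (lam : multinom n) : A :=
  \sum_(T : {ffun cell lam -> 'I_n} | is_ssyt T && [forall c, (T c < k)%N])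
     \prod_c x (T c).

Section TableauBranching.
Variables (A : comNzRingType) (x : nat -> A) (n k M : nat).
Hypothesis lt_kn : (k < n)%N.
Variable lam : multinom n.
Hypothesis Plam : is_partition lam.
Hypothesis lam_k : forall i : 'I_n, (k < i)%N -> lam i = 0%N.
Hypothesis lam_M : forall i : 'I_n, (lam i <= M)%N.
Let kk : 'I_n := Ordinal lt_kn.
Let l (j : nat) : nat := nth 0%N lam j.

Definition ext_seq (e : {ffun 'I_k -> 'I_M.+1}) (j : nat) : nat :=
  if insub j is Some j' then e j' : nat else 0%N.

Definition inner_shape (e : {ffun 'I_k -> 'I_M.+1}) : multinom n :=
  Multinom [tuple ext_seq e i | i < n].

Let lE (i : 'I_n) : lam i = l i.
Proof. exact: mnm_nth. Qed.

Lemma inner_shapeE e (i : 'I_n) : inner_shape e i = ext_seq e i.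
Proof. by rewrite mnmE. Qed.

Lemma ext_seq_lt e (j : 'I_k) : ext_seq e j = e j.
Proof. by rewrite /ext_seq valK. Qed.

Lemma ext_seq_ge e j : (k <= j)%N -> ext_seq e j = 0%N.
Proof. by move=> kj; rewrite /ext_seq insubF // ltnNge kj. Qed.

Let inner_le e (i : 'I_n) : interlaces l e -> (inner_shape e i <= lam i)%N.
Proof.
move=> /forallP He; rewrite inner_shapeE.
case: (ltnP i k) => ik; last by rewrite ext_seq_ge.
by have /andP[_] := He (Ordinal ik); rewrite -ext_seq_lt lE.
Qed.

Let le_inner e (i i' : 'I_n) : interlaces l e -> (i < i')%N ->
  (lam i' <= inner_shape e i)%N.
Proof.
move=> /forallP He ii'; rewrite inner_shapeE.
case: (ltnP i k) => ik; last by rewrite lam_k // (leq_ltn_trans ik).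
have /andP[H _] := He (Ordinal ik); rewrite -ext_seq_lt /= in H.
apply: leq_trans H; have lt_i1n : (i.+1 < n)%N by apply: leq_ltn_trans (ltn_ord i').
rewrite -(lE (Ordinal lt_i1n)).
by move/is_partitionP: Plam; apply.
Qed.

Lemma inner_partition e : interlaces l e -> is_partition (inner_shape e).
Proof.
move=> He; apply/is_partitionP=> i j; rewrite leq_eqVlt => /orP[/eqP ij|ij].
  by rewrite (val_inj ij).
exact: leq_trans (inner_le _ He) (le_inner He ij).
Qed.

Let outer e (T' : {ffun cell (inner_shape e) -> 'I_n}) : {ffun cell lam -> 'I_n} :=
  [ffun c : cell lam => entry lt_kn T' (tag c) (tagged c)].
Let inner e (T : {ffun cell lam -> 'I_n}) : {ffun cell (inner_shape e) -> 'I_n} :=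
  [ffun c : cell (inner_shape e) => entry lt_kn T (tag c) (tagged c)].

Let outerE e T' (i : 'I_n) j : (j < lam i)%N ->
  entry lt_kn (@outer e T') i j = entry lt_kn T' i j.
Proof. exact: entry_finfun. Qed.

Let innerE e T (i : 'I_n) j : (j < inner_shape e i)%N ->
  entry lt_kn (inner e T) i j = entry lt_kn T i j.
Proof. exact: entry_finfun. Qed.

Let cut (T : {ffun cell lam -> 'I_n}) : {ffun 'I_k -> 'I_M.+1} :=
  [ffun j => inord (row_cut lt_kn T (widen_ord (ltnW lt_kn) j))].

Let cutE T (j : 'I_k) : cut T j = row_cut lt_kn T (widen_ord (ltnW lt_kn) j) :> nat.
Proof.
by rewrite ffunE inordK // ltnS; apply: leq_trans (row_cut_le _ _ _) (lam_M _).
Qed.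

Let P m (mu : multinom n) (T : {ffun cell mu -> 'I_n}) :=
  is_ssyt T && [forall c, (T c < m)%N].

Let cut_interlaces T : P k.+1 T -> interlaces l (cut T).
Proof.
case/andP=> ssT lt_T; apply/forallP=> j; rewrite cutE.
set i := widen_ord _ j; have le_c := row_cut_le lt_kn T i.
apply/andP; split; last by rewrite -(lE i).
have lt_j1n : (j.+1 < n)%N by apply: leq_ltn_trans lt_kn.
rewrite -(lE (Ordinal lt_j1n)) leqNgt; apply/negP => cj.
have ji : (row_cut lt_kn T i < lam i)%N.
  by apply: leq_trans cj _; move/is_partitionP: Plam; apply => /=.
have := entry_lt_cut lt_kn ssT ji; rewrite ltnn => /negbT/negP; apply.
have [_ Hc] := elimT (ssyt_entryP lt_kn T) ssT.
have lt := Hc i (Ordinal lt_j1n) _ (ltnSn j) ji cj.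
by apply: leq_trans lt _; rewrite -ltnS (elimT (entries_ltP lt_kn T _) lt_T).
Qed.

Let inner_shape_ge e (i : 'I_n) : (k <= i)%N -> inner_shape e i = 0%N.
Proof. by move=> ki; rewrite inner_shapeE ext_seq_ge. Qed.

Let cut_shape e T (i : 'I_n) (j : nat) : P k.+1 T -> cut T = e ->
  (j < lam i)%N -> (entry lt_kn T i j < k)%N = (j < inner_shape e i)%N.
Proof.
case/andP=> ssT _ <- ji; case: (ltnP i k) => ik.
  rewrite entry_lt_cut // inner_shapeE (ext_seq_lt _ (Ordinal ik)) cutE.
  by congr (_ < row_cut _ _ _)%N; apply: val_inj.
rewrite inner_shape_ge // ltn0; apply/negbTE; rewrite -leqNgt.
exact: leq_trans ik (ssyt_entry_ge lt_kn Plam ssT ji).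
Qed.

Let outer_inner e T : P k.+1 T -> cut T = e -> outer (inner e T) = T.
Proof.
move=> PT cT; apply: (@entry_inj _ _ lt_kn) => i j ji; rewrite outerE //.
case: (ltnP j (inner_shape e i)) => je; first exact: innerE.
rewrite entry_out //; apply: val_inj => /=; apply/eqP.
rewrite eqn_leq [X in X && _]leqNgt (cut_shape PT cT) // ltnNge je /=.
rewrite -ltnS; case/andP: PT => _ H.
exact: (elimT (entries_ltP lt_kn T _)).
Qed.

Let outer_cond e T' : interlaces l e ->
  (P k.+1 (outer T') && (cut (outer T') == e)) && (inner e (outer T') == T') =
  P k T'.
Proof.
move=> He; have le_in i := inner_le i He.
apply/idP/idP => [/andP[/andP[PT /eqP cT] _]|].
  have lt_j i j : (j < inner_shape e i)%N -> (j < lam i)%N.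
    by move/leq_trans; apply.
  have E i j : (j < inner_shape e i)%N ->
      entry lt_kn T' i j = entry lt_kn (outer T') i j.
    by move=> je; rewrite outerE ?lt_j.
  have /andP[ssT _] := PT.
  have [Hr Hc] := elimT (ssyt_entryP lt_kn _) ssT.
  apply/andP; split; last first.
    apply/(entries_ltP lt_kn) => i j je.
    by rewrite E // (cut_shape PT cT) ?lt_j.
  apply/(ssyt_entryP lt_kn); split=> [i j j' jj' j'e | i i' j ii' ji ji'].
    by rewrite !E ?(leq_ltn_trans jj') // Hr ?lt_j.
  by rewrite !E // Hc ?lt_j.
case/andP=> ssT' lt_T'.
have [Hr Hc] := elimT (ssyt_entryP lt_kn _) ssT'.
have ltk := elimT (entries_ltP lt_kn T' _) lt_T'.
have le_k i j : (entry lt_kn T' i j <= k)%N.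
  case: (ltnP j (inner_shape e i)) => je; first exact/ltnW/ltk.
  by rewrite entry_out.
have ssT : is_ssyt (outer T').
  apply/(ssyt_entryP lt_kn); split=> [i j j' jj' j'l | i i' j ii' ji ji'].
    rewrite !outerE ?(leq_ltn_trans jj') //.
    case: (ltnP j' (inner_shape e i)) => j'e; first exact: Hr.
    by rewrite [entry _ _ _ j']entry_out.
  rewrite !outerE //.
  have je : (j < inner_shape e i)%N by apply: leq_trans ji' (le_inner He ii').
  case: (ltnP j (inner_shape e i')) => je'; first exact: Hc.
  by rewrite [entry _ _ i' _]entry_out //=; apply: ltk.
have PT : P k.+1 (outer T').
  rewrite /P ssT; apply/(entries_ltP lt_kn) => i j ji.
  by rewrite outerE // ltnS.
rewrite PT /=; apply/andP; split; apply/eqP; last first.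
  apply: (@entry_inj _ _ lt_kn) => i j je; rewrite innerE //.
  by rewrite outerE // (leq_trans je).
apply/ffunP=> j; apply: val_inj; rewrite /= cutE.
set i := widen_ord _ j.
have -> : e j = inner_shape e i :> nat.
  by rewrite inner_shapeE -ext_seq_lt.
apply: row_cut_eq => // j' j'l; rewrite outerE //.
case: (ltnP j' (inner_shape e i)) => je; first exact: ltk.
by rewrite entry_out //= ltnn.
Qed.

Let prod_outer e (T' : {ffun cell (inner_shape e) -> 'I_n}) : interlaces l e ->
  \prod_c x (outer T' c) =
  x k ^+ (l k + \sum_(j < k) (l j - e j)) * \prod_c x (T' c).
Proof.
move=> He; rewrite !(prod_entries lt_kn).
transitivity (\prod_(i < n) (x k ^+ (lam i - inner_shape e i) *
   \prod_(0 <= j < inner_shape e i) x (entry lt_kn T' i j))).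
  apply: eq_bigr => i _; rewrite (big_cat_nat (n := inner_shape e i)) //=;
    last exact: inner_le.
  rewrite mulrC; congr (_ * _).
    rewrite -prodr_const_nat !big_nat; apply: eq_bigr => j /andP[ej jl].
    by rewrite outerE // entry_out.
  rewrite !big_nat; apply: eq_bigr => j /andP[_ je].
  by rewrite outerE // (leq_trans je) // inner_le.
rewrite big_split prodrXr; congr (_ ^+ _ * _).
transitivity (\sum_(i < n) (l i - ext_seq e i))%N.
  by apply: eq_bigr => i _; rewrite lE inner_shapeE.
rewrite -(big_mkord xpredT (fun i => l i - ext_seq e i)%N).
rewrite (big_cat_nat (n := k.+1)) //= [X in (_ + X)%N]big_nat.
rewrite [X in (_ + X)%N]big1 => [|i /andP[ki lt_in]]; last first.
  by rewrite -(lE (Ordinal lt_in)) lam_k.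
rewrite addn0 big_nat_recr //= ext_seq_ge // subn0 addnC big_mkord.
by congr (_ + _)%N; apply: eq_bigr => j _; rewrite ext_seq_lt.
Qed.

(** The cells with entry k form a horizontal strip, so deleting them leaves a
tableau whose shape e interlaces with l; conversely, filling up with k the
cells between an interlacing e and l is always allowed. *)
Lemma ssyt_sum_branching :
  ssyt_sum x k.+1 lam =
  \sum_(e : {ffun 'I_k -> 'I_M.+1} | interlaces l e)
     x k ^+ (l k + \sum_(j < k) (l j - e j)) * ssyt_sum x k (inner_shape e).
Proof.
rewrite /ssyt_sum (partition_big cut (interlaces l)) => [|T]; last first.
  exact: cut_interlaces.
apply: eq_bigr => e He.
rewrite (reindex_onto (@outer e) (inner e)) => [|T /andP[PT /eqP cT]];
  last exact: outer_inner.
rewrite mulr_sumr; apply: eq_big => [T'|T' _]; first exact: outer_cond.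
exact: prod_outer.
Qed.

End TableauBranching.

(** [ssyt_sum_branching] and [bialternant_branching] have the same sum over e,
and the product of the x i - x k in the latter is exactly the quotient of the
Vandermonde determinants in k + 1 and k variables. *)
Lemma ssyt_sum_bialternant (A : comNzRingType) (x : nat -> A) n k
    (lam : multinom n) : (k <= n)%N -> is_partition lam ->
  (forall i : 'I_n, (k <= i)%N -> lam i = 0%N) ->
  ssyt_sum x k lam * bialternant x k (fun=> 0%N) = bialternant x k (nth 0%N lam).
Proof.
elim: k lam => [|k IH] lam le_kn Plam lam0.
  rewrite /bialternant !det_mx00 mulr1 /ssyt_sum.
  have no_cell (c : cell lam) : False.
    by case: c => i j; have := ltn_ord j; rewrite [X in (_ < X)%N]lam0.
  pose T0 : {ffun cell lam -> 'I_n} := [ffun c => match no_cell c with end].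
  rewrite (bigD1 T0) /=.
    rewrite [X in _ + X]big1 ?addr0 => [|T /andP[_ /eqP[]]]; last first.
      by apply/ffunP=> c; case: (no_cell c).
    by rewrite big1 // => c; case: (no_cell c).
  by apply/andP; split; apply/forallP=> c; case: (no_cell c).
have lt_kn : (k < n)%N by [].
pose l := nth 0%N lam.
have lE (i : 'I_n) : lam i = l i by exact: mnm_nth.
have l_ge j : (n <= j)%N -> l j = 0%N.
  by move=> nj; rewrite /l nth_default // size_tuple.
pose M := mdeg lam.
have lam_M (i : 'I_n) : (lam i <= M)%N by rewrite /M mdegE (bigD1 i) //= leq_addr.
have l_M j : (l j < M.+1)%N.
  case: (ltnP j n) => jn; last by rewrite l_ge.
  by rewrite ltnS -(lE (Ordinal jn)).
have l_dec j : (l j.+1 <= l j)%N.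
  case: (ltnP j.+1 n) => jn; last by rewrite l_ge.
  rewrite -(lE (Ordinal jn)) -(lE (Ordinal (ltnW jn))).
  by move/is_partitionP: Plam; apply => /=.
have lam_k (i : 'I_n) : (k < i)%N -> lam i = 0%N by apply: lam0.
set p := \prod_(i < k) (x i - x k).
have bialternant0 : bialternant x k.+1 (fun=> 0%N) = p * bialternant x k (fun=> 0%N).
  rewrite (bialternant_branching (M := M.+1) x k (l := fun=> 0%N)) //.
  pose e0 : {ffun 'I_k -> 'I_M.+1} := [ffun=> ord0].
  rewrite (bigD1 e0) /=; last by apply/forallP=> j; rewrite ffunE.
  rewrite [X in _ * (_ + X)]big1 ?addr0; last first.
    move=> e /andP[/forallP He /eqP[]]; apply/ffunP=> j; apply: val_inj.
    by have := He j; rewrite leqn0 => /eqP Ej; rewrite /= Ej ffunE.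
  have -> : (0 + \sum_(j < k) (0 - e0 j) = 0)%N by rewrite add0n big1.
  rewrite expr0 mul1r; congr (_ * \det _).
  by apply/matrixP=> i j; rewrite !mxE valK ffunE.
rewrite (bialternant_branching x k l_dec l_M) bialternant0 -/p.
rewrite (ssyt_sum_branching x lt_kn Plam lam_k lam_M) mulrCA; congr (_ * _).
rewrite mulr_suml; apply: eq_bigr => e He; rewrite -mulrA; congr (_ * _).
rewrite (IH _ (ltnW lt_kn) (inner_partition Plam lam_k He)); last first.
  by move=> i ki; rewrite inner_shapeE ext_seq_ge.
congr (\det _); apply/matrixP=> i j; rewrite !mxE.
have jn : (j < n)%N by apply: ltn_trans lt_kn.
by rewrite -(mnm_nth _ _ (Ordinal jn)) inner_shapeE.
Qed.

Section TableauSchur.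
Variables (K : comNzRingType) (n : nat).
Implicit Types lam eta : multinom n.

Definition variable_seq (j : nat) : mpoly n K :=
  nth 0 [tuple mpolyX K (mnm1 i) | i < n] j.

Lemma variable_seqE (i : 'I_n) : variable_seq i = mpolyX K (mnm1 i).
Proof. by rewrite /variable_seq -tnth_nth tnth_mktuple. Qed.

Definition tableau_schur lam : mpoly n K := ssyt_sum variable_seq n lam.

Lemma tableau_schurE lam :
  tableau_schur lam =
  \sum_(T : {ffun cell lam -> 'I_n} | is_ssyt T) \prod_c mpolyX K (mnm1 (T c)).
Proof.
apply: eq_big => [T|T _]; last by apply: eq_bigr => c _; rewrite variable_seqE.
by rewrite (_ : [forall c, _] = true) ?andbT //; apply/forallP=> c.
Qed.

Lemma tableau_schur_alt lam : is_partition lam ->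
  tableau_schur lam * alt_poly K (delta n) = alt_poly K (mnm_add lam (delta n)).
Proof.
move=> Plam.
have := ssyt_sum_bialternant variable_seq (leqnn n) Plam.
have -> : bialternant variable_seq n (fun=> 0%N) = alt_poly K (delta n).
  congr (\det _); apply/matrixP=> i j; rewrite !mxE variable_seqE add0n.
  by rewrite mnmE.
have -> : bialternant variable_seq n (nth 0%N lam) = alt_poly K (mnm_add lam (delta n)).
  congr (\det _); apply/matrixP=> i j; rewrite !mxE variable_seqE.
  by rewrite mnmDE mnmE (mnm_nth 0%N).
by apply => i; rewrite leqNgt ltn_ord.
Qed.

Lemma mcoeff_tableau_schur lam eta :
  mcoeff eta (tableau_schur lam) = (kostka lam eta)%:R.
Proof.
rewrite tableau_schurE raddf_sum /= /kostka -sum1_card natr_sum.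
rewrite big_mkcond [RHS]big_mkcond; apply: eq_bigr => T _.
rewrite inE; case: (is_ssyt T) => //=.
pose w : multinom n := Multinom [tuple #|[set c | T c == k]%SET| | k < n].
have -> : \prod_c mpolyX K (mnm1 (T c)) = mpolyX K w.
  rewrite mprodXE; congr mpolyX; apply/mnmP=> k; rewrite mnm_sumE mnmE.
  rewrite -sum1_card [RHS]big_mkcond; apply: eq_bigr => c _.
  by rewrite mnm1E inE; case: eqP.
rewrite mcoeffX (_ : (w == eta) = has_weight eta T); last first.
  apply/eqP/forallP => [<- k|H]; first by rewrite mnmE.
  by apply/mnmP=> k; rewrite mnmE; apply/eqP.
by case: has_weight.
Qed.

Lemma meval_tableau_schur (v : 'I_n -> K) lam :
  meval v (tableau_schur lam) =
  \sum_(T : {ffun cell lam -> 'I_n} | is_ssyt T) \prod_c v (T c).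
Proof.
rewrite tableau_schurE raddf_sum; apply: eq_bigr => T _ /=.
by rewrite rmorph_prod; apply: eq_bigr => c _; rewrite /= mevalXU.
Qed.

End TableauSchur.

Lemma kostka_mdeg n (lam eta : multinom n) :
  kostka lam eta != 0%N -> mdeg lam = mdeg eta.
Proof.
rewrite -lt0n => /card_gt0P[T]; rewrite inE => /andP[_ /forallP wT].
rewrite [mdeg eta]mdegE.
transitivity (\sum_(k < n) #|[set c | T c == k]%SET|)%N; last first.
  by apply: eq_bigr => k _; apply/eqP.
transitivity #|cell lam|.
  rewrite card_tagged sumnE big_map mdegE.
  by rewrite [RHS]big_enum /=; apply: eq_bigr => i _; rewrite card_ord.
rewrite -sum1_card (partition_big T xpredT) //=; apply: eq_bigr => k _.
by rewrite -sum1_card; apply: eq_bigl => c; rewrite inE.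
Qed.

(** * Derivations of the ring of polynomials in the matrix entries *)

Section GenericMatrix.
Variables (K : comNzRingType) (n : nat).
Local Notation B := (mpoly (n * n) K).

Definition generic_mx : 'M[B]_n :=
  \matrix_(i, j) mpolyX K (mnm1 (mxvec_index i j)).

Definition mx_eval (A : comNzRingType) (f : {rmorphism K -> A}) (M : 'M[A]_n)
    (F : B) : A := mmap f (fun t => mxvec M 0 t) F.

HB.instance Definition _ (A : comNzRingType) (f : {rmorphism K -> A})
  (M : 'M[A]_n) := GRing.RMorphism.copy (mx_eval f M)
                     (mmap f (fun t => mxvec M 0 t)).

Lemma mx_evalC (A : comNzRingType) (f : {rmorphism K -> A}) M c :
  mx_eval f M (mpolyC _ c) = f c.
Proof. exact: mmapC. Qed.

Lemma mx_eval_monomial (A : comNzRingType) (f : {rmorphism K -> A}) M m :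
  mx_eval f M (mpolyX K m) = \prod_t mxvec M 0 t ^+ m t.
Proof. by rewrite /mx_eval mmapX. Qed.

Lemma mx_evalX (A : comNzRingType) (f : {rmorphism K -> A}) M i j :
  mx_eval f M (generic_mx i j) = M i j.
Proof. by rewrite mxE /mx_eval mmapX mmap1U mxvecE. Qed.

Lemma eq_mx_eval (A : comNzRingType) (f f' : {rmorphism K -> A}) M :
  f =1 f' -> mx_eval f M =1 mx_eval f' M.
Proof. by move=> ff' F; apply: eq_bigr => m _; rewrite ff'. Qed.

Lemma mx_eval_comp (A A' : comNzRingType) (f : {rmorphism K -> A})
    (phi : {rmorphism A -> A'}) M F :
  phi (mx_eval f M F) = mx_eval (phi \o f) (map_mx phi M) F.
Proof.
rewrite /mx_eval /mmap raddf_sum; apply: eq_bigr => m _ /=.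
rewrite rmorphM rmorph_prod; congr (_ * _); apply: eq_bigr => t _.
rewrite /= rmorphXn; congr (_ ^+ _).
by case/mxvec_indexP: t => i j; rewrite !mxvecE mxE.
Qed.

Lemma mx_eval_generic F : mx_eval (@mpolyC (n * n) K) generic_mx F = F.
Proof.
rewrite [RHS]mpolyE /mx_eval /mmap; apply: eq_bigr => m _.
rewrite mul_mpolyC [in RHS]mpolyXE_id; congr (_ *: _).
apply: eq_bigr => t _; congr (_ ^+ _).
by case/mxvec_indexP: t => i j; rewrite mxvecE mxE.
Qed.

Lemma mpoly_derivation_ext N (d : {additive mpoly N K -> mpoly N K}) :
  (forall p q, d (p * q) = d p * q + p * d q) ->
  (forall c, d (mpolyC N c) = 0) -> (forall i, d (mpolyX K (mnm1 i)) = 0) ->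
  forall F, d F = 0.
Proof.
move=> dM dC dX F; rewrite [F]mpolyE raddf_sum big1 // => m _ /=.
rewrite -mul_mpolyC dM dC mul0r add0r [mpolyX K m]mpolyXE_id.
rewrite (_ : d _ = 0) ?mulr0 //; elim/big_ind: _ => [|p q p0 q0|i _].
- exact: derivation1.
- by rewrite dM p0 q0 mul0r mulr0 addr0.
by elim: (m i) => [|l IH]; rewrite ?expr0 ?(derivation1 dM) // exprS dM dX IH
  mul0r mulr0 addr0.
Qed.

Local Notation mxC := (map_mx (@mpolyC (n * n) K)).

Definition commutator_mx (A : 'M[K]_n) : 'M[B]_n :=
  mxC A *m generic_mx - generic_mx *m mxC A.

Definition mx_derivation (C : 'M[B]_n) (F : B) : B :=
  \sum_i \sum_j C i j * mderiv (mxvec_index i j) F.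

Lemma mx_derivationDl C1 C2 F :
  mx_derivation (C1 + C2) F = mx_derivation C1 F + mx_derivation C2 F.
Proof.
rewrite /mx_derivation -big_split; apply: eq_bigr => i _ /=.
by rewrite -big_split; apply: eq_bigr => j _ /=; rewrite mxE mulrDl.
Qed.

Lemma mx_derivationZl c C F :
  mx_derivation (c *: C) F = c * mx_derivation C F.
Proof.
rewrite /mx_derivation mulr_sumr; apply: eq_bigr => i _.
by rewrite mulr_sumr; apply: eq_bigr => j _; rewrite mxE mulrA.
Qed.

Lemma mx_derivation_is_additive C : zmod_morphism (mx_derivation C).
Proof.
move=> p q; rewrite /mx_derivation -sumrB; apply: eq_bigr => i _.
rewrite -sumrB; apply: eq_bigr => j _.
by rewrite raddfB mulrBr.
Qed.

HB.instance Definition _ C :=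
  GRing.isZmodMorphism.Build B B (mx_derivation C) (mx_derivation_is_additive C).

Lemma mx_derivationM C p q :
  mx_derivation C (p * q) = mx_derivation C p * q + p * mx_derivation C q.
Proof.
rewrite /mx_derivation mulr_suml mulr_sumr -big_split; apply: eq_bigr => i _ /=.
rewrite mulr_suml mulr_sumr -big_split; apply: eq_bigr => j _ /=.
by rewrite mderivM; ring.
Qed.

Lemma mx_derivationC C c : mx_derivation C (mpolyC _ c) = 0.
Proof.
by rewrite /mx_derivation big1 // => i _; rewrite big1 // => j _; rewrite mderivC mulr0.
Qed.

Lemma mxvec_index_inj (i i' j j' : 'I_n) :
  (mxvec_index i j == mxvec_index i' j') = (i == i') && (j == j').
Proof.
rewrite /mxvec_index (inj_eq (@cast_ord_inj _ _ _)) (inj_eq enum_rank_inj).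
by rewrite xpair_eqE.
Qed.

Lemma mx_derivationX C i j : mx_derivation C (generic_mx i j) = C i j.
Proof.
have dX a b : mderiv (mxvec_index a b) (generic_mx i j) =
              ((a == i) && (b == j))%:R.
  rewrite mxE mderivX mnm1E mxvec_index_inj eq_sym [j == b]eq_sym.
  case: andP => [[/eqP-> /eqP->]|_]; last by rewrite scale0r.
  by rewrite scale1r (_ : mnm_sub _ _ = mnm0) ?mpolyX0 //; apply/mnmP=> t;
     rewrite mnmBE subnn mnm0E.
rewrite /mx_derivation (bigD1 i) //= (bigD1 j) //= dX !eqxx mulr1 big1.
  rewrite addr0 big1 ?addr0 // => a ai; rewrite big1 // => b _.
  by rewrite dX (negPf ai) mulr0.
by move=> b bj; rewrite dX (negPf bj) andbF mulr0.
Qed.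

Lemma mx_derivation_ext (d : {additive B -> B}) (C : 'M[B]_n) :
  (forall p q, d (p * q) = d p * q + p * d q) ->
  (forall c, d (mpolyC _ c) = 0) ->
  (forall i j, d (generic_mx i j) = C i j) ->
  d =1 mx_derivation C.
Proof.
move=> dM dC dX F.
pose e F := d F - mx_derivation C F.
have eB : zmod_morphism e by move=> p q; rewrite /e !raddfB /=; ring.
pose e' := HB.pack_for {additive B -> B} e
  (GRing.isZmodMorphism.Build B B e eB).
suff : e' F = 0 by move/eqP; rewrite subr_eq0 => /eqP.
apply: mpoly_derivation_ext => [p q|c|t].
- by rewrite /= /e dM mx_derivationM; ring.
- by rewrite /= /e dC mx_derivationC subrr.
case/mxvec_indexP: t => i j.
have := mx_derivationX C i j; have := dX i j; rewrite mxE => dij mij.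
by rewrite /= /e dij mij subrr.
Qed.

(** Euler's identity for homogeneous polynomials. *)
Lemma euler_monomial m :
  mx_derivation generic_mx (mpolyX K m) = (mpolyX K m) *+ mdeg m.
Proof.
transitivity (\sum_(t < n * n) mpolyX K (mnm1 t) * mderiv t (mpolyX K m)).
  rewrite (reindex (uncurry (@mxvec_index n n))) /=; last exact: curry_mxvec_bij.
  rewrite /mx_derivation pair_bigA; apply: eq_bigr => -[i j] _ /=.
  by rewrite mxE.
rewrite mdegE -sumrMnr; apply: eq_bigr => t _.
rewrite mderivX -scalerAr -mpolyXD scaler_nat.
case: (posnP (m t)) => [->|mt]; first by rewrite !mulr0n.
congr (mpolyX K _ *+ _); apply/mnmP=> s; rewrite mnmDE mnmBE mnm1E subnKC //.
by case: eqP => // <-.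
Qed.

End GenericMatrix.

(** * Infinitesimal form of the unitary invariance *)

Local Open Scope sesquilinear_scope.

(** The Cayley transform, which maps the real line injectively to the unit
circle. *)
Definition circle_point (K : numClosedFieldType) (m : nat) : K :=
  (1 + m%:R * 'i) / (1 - m%:R * 'i).

Section CirclePoint.
Variable K : numClosedFieldType.
Local Notation om := (circle_point K).

Let den_neq0 m : 1 - m%:R * 'i != 0 :> K.
Proof.
apply/eqP => E; have : (m ^ 2).+1%:R = 0 :> K; last by move/eqP; rewrite pnatr_eq0.
transitivity ((1 - m%:R * 'i) * (1 + m%:R * 'i) : K); last by rewrite E mul0r.
rewrite -natr1 natrX; have := sqrCi K; rewrite !expr2 => i2.
by rewrite mulrDr mulr1 mulrBl mul1r mulrACA i2; ring.
Qed.

Lemma circle_point_conj m : om m * (om m)^* = 1.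
Proof.
rewrite /circle_point rmorphM fmorphV rmorphD rmorphB rmorphM /= conjCi.
rewrite rmorph1 conjC_nat mulrN opprK mulrACA -invfM.
rewrite [(1 - _) * (1 + _)]mulrC divff // mulf_neq0 //.
have := den_neq0 m; rewrite -conjC_eq0 rmorphB rmorphM /= conjCi rmorph1.
by rewrite conjC_nat mulrN opprK.
Qed.

Lemma circle_point_inj : injective om.
Proof.
move=> m k /eqP; rewrite /circle_point eqr_div //.
rewrite -subr_eq0.
have -> : (1 + m%:R * 'i) * (1 - k%:R * 'i) - (1 + k%:R * 'i) * (1 - m%:R * 'i)
  = (2 * 'i) * (m%:R - k%:R) :> K by ring.
rewrite mulf_eq0 mulf_eq0 pnatr_eq0 /= (negPf (neq0Ci _)) /= subr_eq0.
by rewrite eqr_nat => /eqP.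
Qed.

End CirclePoint.

Lemma rotation_product (K : comNzRingType) n (p q : 'M[K]_n) c d :
  p *m p = p -> q *m q = q -> p *m q = 0 -> q *m p = 0 ->
  (p + c *: q) *m (p + d *: q) = p + (c * d) *: q.
Proof.
move=> pp qq pq qp; rewrite mulmxDl !mulmxDr -!scalemxAr -!scalemxAl.
by rewrite pp qq pq qp !scaler0 addr0 add0r scalerA mulrC.
Qed.

Lemma conjugation_expand (K : comNzRingType) n (p q M : 'M[K]_n) a b :
  a * b = 1 ->
  a *: ((p + a *: q) *m M *m (p + b *: q)) =
  a ^+ 2 *: (q *m M *m p) + a *: (q *m M *m q + p *m M *m p) + p *m M *m q.
Proof.
move=> ab; rewrite !mulmxDl !mulmxDr -!scalemxAl -!scalemxAr.
move: (p *m M *m p) (p *m M *m q) (q *m M *m p) (q *m M *m q) => P Q R S.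
by apply/matrixP=> i j; rewrite !mxE; ring: ab.
Qed.

Lemma horner_quadratic_mx (R : comNzRingType) n (P Q S : 'M[R]_n) c :
  map_mx (horner_eval c) ('X^2 *: map_mx polyC P + 'X *: map_mx polyC Q
                          + map_mx polyC S) = c ^+ 2 *: P + c *: Q + S.
Proof.
by apply/matrixP=> i j; rewrite !mxE /horner_eval !(hornerE, hornerXn).
Qed.

Lemma deriv_quadratic_mx (R : comNzRingType) n (P Q S : 'M[R]_n) i j :
  (('X^2 *: map_mx polyC P + 'X *: map_mx polyC Q + map_mx polyC S) i j)^`().[1]
  = P i j *+ 2 + Q i j.
Proof.
rewrite !mxE !derivD !derivM !derivX !derivC !hornerE.
by rewrite [LHS]addr0 mulrDl mul1r mulr2n.
Qed.

Section OrbitPolynomial.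
Variables (K : comNzRingType) (n : nat).
Local Notation B := (mpoly (n * n) K).
Local Notation C := (@mpolyC (n * n) K).
Local Notation X := (generic_mx K n).
Variables (W W' : 'M[B]_n).

(** For complementary projections W and W', this is the conjugate of the
generic matrix by W' + 'X W, multiplied by 'X in order to clear the
denominator that comes from the inverse W' + 'X^-1 W. *)
Definition orbit_mx : 'M[{poly B}]_n :=
  'X^2 *: map_mx polyC (W *m X *m W')
  + 'X *: map_mx polyC (W *m X *m W + W' *m X *m W')
  + map_mx polyC (W' *m X *m W).

Definition orbit_poly (F : B) : {poly B} := mx_eval (polyC \o C) orbit_mx F.

HB.instance Definition _ :=
  GRing.RMorphism.copy orbit_poly (mx_eval (polyC \o C) orbit_mx).

Lemma orbit_poly_at c d F : C c * C d = 1 ->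
  (orbit_poly F).[C c] =
  mx_eval C (C c *: ((W' + C c *: W) *m X *m (W' + C d *: W))) F.
Proof.
move=> cd; rewrite -[(_).[_]]/(horner_eval (C c) (mx_eval _ _ _)) mx_eval_comp.
rewrite (conjugation_expand _ _ _ cd) horner_quadratic_mx.
by apply: eq_mx_eval => e; rewrite /= /horner_eval hornerC.
Qed.

Hypothesis WE : W' = 1%:M - W.

Lemma orbit_poly1 F : (orbit_poly F).[1] = F.
Proof.
rewrite -mpolyC1 (@orbit_poly_at 1 1); last by rewrite mpolyC1 mulr1.
by rewrite mpolyC1 !scale1r WE subrK mul1mx mulmx1 mx_eval_generic.
Qed.

Definition orbit_derivation (F : B) : B := (orbit_poly F)^`().[1].

Lemma orbit_derivation_is_additive : zmod_morphism orbit_derivation.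
Proof.
by move=> p q; rewrite /orbit_derivation rmorphB derivB hornerD hornerN.
Qed.

HB.instance Definition _ :=
  GRing.isZmodMorphism.Build B B orbit_derivation orbit_derivation_is_additive.

Lemma orbit_derivationM p q : orbit_derivation (p * q) =
  orbit_derivation p * q + p * orbit_derivation q.
Proof.
rewrite /orbit_derivation rmorphM derivM hornerD !hornerM.
by congr (_ * _ + _ * _); exact: orbit_poly1.
Qed.

(** The derivative at 1 of c times the conjugate by W' + c W; the summand X
comes from the factor c. *)
Lemma orbit_derivationE F :
  orbit_derivation F = mx_derivation (X + (W *m X - X *m W)) F.
Proof.
apply: mx_derivation_ext => [p q|c|i j]; first exact: orbit_derivationM.
  by rewrite /= /orbit_derivation /orbit_poly mx_evalC derivC horner0.
rewrite /= /orbit_derivation /orbit_poly mx_evalX deriv_quadratic_mx WE.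
rewrite !mulmxBr !mulmxBl !mulmx1 !mul1mx.
move: (W *m X) (X *m W) (W *m X *m W) => P Q S.
by rewrite !mxE; ring.
Qed.

End OrbitPolynomial.

Section InfinitesimalInvariance.
Variables (K : numClosedFieldType) (n : nat).
Local Notation B := (mpoly (n * n) K).
Local Notation C := (@mpolyC (n * n) K).
Local Notation mxC := (map_mx (@mpolyC (n * n) K)).
Local Notation X := (generic_mx K n).
Variable E : {additive B -> K}.
Hypothesis EC : forall c F, E (C c * F) = c * E F.
Hypothesis E_inv : forall (u : 'M[K]_n) F, u \is unitarymx ->
  E (mx_eval C (mxC u *m X *m mxC (invmx u)) F) = E F.

Let horner_map_E (p : {poly B}) c : (map_poly E p).[c] = E p.[C c].
Proof.
rewrite /map_poly horner_poly horner_coef raddf_sum; apply: eq_bigr => i _ /=.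
by rewrite -rmorphXn /= [p`_i * _]mulrC EC mulrC.
Qed.

Let deriv_map_E (p : {poly B}) : (map_poly E p)^`() = map_poly E p^`().
Proof. by apply/polyP=> i; rewrite coef_deriv !coef_map coef_deriv raddfMn. Qed.

Section Projection.
Variables w w' : 'M[K]_n.
Hypothesis ww : w *m w = w.
Hypothesis wH : w^t* = w.
Hypothesis w'E : w' = 1%:M - w.

Let w'w : w' *m w = 0. Proof. by rewrite w'E mulmxBl mul1mx ww subrr. Qed.
Let ww' : w *m w' = 0. Proof. by rewrite w'E mulmxBr mulmx1 ww subrr. Qed.
Let w'w' : w' *m w' = w'.
Proof. by rewrite {1}w'E mulmxBl mul1mx ww' subr0. Qed.

Let rotationM c d : c * d = 1 -> (w' + c *: w) *m (w' + d *: w) = 1%:M.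
Proof.
move=> cd; rewrite (rotation_product c d w'w' ww w'w ww').
by rewrite cd scale1r w'E subrK.
Qed.

Let rotation_unitary c : c * c^* = 1 -> w' + c *: w \is unitarymx.
Proof.
move=> cc; apply/unitarymxP; rewrite -(rotationM cc); congr (_ *m _).
rewrite w'E linearD linearB linearZ /= trmx1.
by rewrite map_mxD map_mxB map_mx1 map_mxZ wH.
Qed.

Let invmx_rotation c d : c * d = 1 -> invmx (w' + c *: w) = w' + d *: w.
Proof.
move=> cd; have u1 := rotationM cd; have [ru _] := mulmx1_unit u1.
by rewrite -[RHS]mul1mx -(mulVmx ru) -mulmxA u1 mulmx1.
Qed.

Let rotC d : mxC (w' + d *: w) = mxC w' + C d *: mxC w.
Proof. by apply/matrixP=> i j; rewrite !mxE mpolyCD mpolyCM. Qed.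

Let E_orbit_poly m c : c * c^* = 1 ->
  E (orbit_poly (mxC w) (mxC w') (mpolyX K m)).[C c] =
  c ^+ mdeg m * E (mpolyX K m).
Proof.
move=> cc; have cC : C c * C c^* = 1 by rewrite -mpolyCM cc mpolyC1.
rewrite -[E (mpolyX K m)](E_inv _ (rotation_unitary cc)) (invmx_rotation cc) -EC.
congr (E _); rewrite (orbit_poly_at _ _ _ cC) !rotC.
rewrite !mx_eval_monomial rmorphXn /= mdegE.
rewrite -prodrXr -big_split; apply: eq_bigr => t _ /=.
by case/mxvec_indexP: t => i j; rewrite !mxvecE mxE exprMn.
Qed.

(** For a monomial of degree k, invariance says that the polynomial E p equals
E (X^m) 'X^k at all points of the unit circle, hence everywhere. Its
derivative at 1 contains k E (X^m) on both sides, from the factor 'X in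
[orbit_mx] and by Euler's identity; what remains is the claim. *)
Lemma E_projection_derivation F : E (mx_derivation (commutator_mx w) F) = 0.
Proof.
have -> : E (mx_derivation (commutator_mx w) F) =
    \sum_(m <- msupp F)
       E (mx_derivation (commutator_mx w) (mcoeff m F *: mpolyX K m)).
  by rewrite {1}[F]mpolyE (raddf_sum (mx_derivation _)) raddf_sum.
rewrite big1 // => m _.
rewrite -mul_mpolyC mx_derivationM mx_derivationC mul0r add0r EC.
rewrite (_ : E _ = 0) ?mulr0 //.
pose p := orbit_poly (mxC w) (mxC w') (mpolyX K m).
pose q := map_poly E p - E (mpolyX K m) *: 'X^(mdeg m).
have q0 : q = 0.
  apply: (poly_eq0_inj (@circle_point_inj K)) => l.
  rewrite /q hornerD hornerN hornerZ hornerXn horner_map_E E_orbit_poly.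
    by rewrite mulrC subrr.
  exact: circle_point_conj.
have WE : mxC w' = 1%:M - mxC w by rewrite w'E map_mxB map_mx1.
have p1 : p^`().[1] =
    mpolyX K m *+ mdeg m + mx_derivation (commutator_mx w) (mpolyX K m).
  rewrite -euler_monomial -mx_derivationDl; exact: (orbit_derivationE WE).
have := congr1 (fun p : {poly K} => p^`().[1]) q0.
rewrite /q derivB deriv_map_E derivZ derivXn deriv0 horner0 hornerD hornerN.
rewrite horner_map_E mpolyC1 p1 hornerZ hornerMn hornerXn expr1n raddfD raddfMn /=.
by rewrite mulr_natr addrC addKr.
Qed.

End Projection.

(** Polarization: the projections on the lines spanned by e_k + c e_j, with c
= 1 and c = 'i, give two linear equations between the values at e_kj and e_jk.
*)
Lemma E_commutator_derivation (k j : 'I_n) F : k != j ->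
  E (mx_derivation (commutator_mx (delta_mx k j)) F) = 0.
Proof.
move=> kj.
pose f (A : 'M[K]_n) := E (mx_derivation (commutator_mx A) F).
have fD A1 A2 : f (A1 + A2) = f A1 + f A2.
  rewrite /f -raddfD -mx_derivationDl; congr (E (mx_derivation _ _)).
  by rewrite /commutator_mx map_mxD mulmxDl mulmxDr opprD addrACA.
have fZ c A : f (c *: A) = c * f A.
  rewrite /f -EC -mx_derivationZl; congr (E (mx_derivation _ _)).
  by rewrite /commutator_mx map_mxZ -scalemxAl -scalemxAr scalerBr.
have f_rank1 (v : 'cV[K]_n) s : s != 0 -> s^* = s -> v^t* *m v = s%:M ->
    f (v *m v^t*) = 0.
  move=> s0 sR vv; pose w := s^-1 *: (v *m v^t*).
  have -> : v *m v^t* = s *: w by rewrite /w scalerA divff // scale1r.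
  rewrite fZ /f (E_projection_derivation _ _ erefl) ?mulr0 //.
    rewrite /w -scalemxAl -scalemxAr mulmxA -[v *m _ *m v]mulmxA vv.
    by rewrite mul_mx_scalar -scalemxAl scalerA mulVf // scale1r.
  rewrite /w linearZ /= map_mxZ trmx_mul map_mxM fmorphV /= sR.
  by rewrite map_trmx trmxK -map_mx_comp map_mx_id // => x; rewrite /= conjCK.
rewrite -/(f _); clearbody f.
have f_diag i : f (delta_mx i i) = 0.
  have E1 : (delta_mx i 0 : 'cV[K]_n)^t* = delta_mx 0 i.
    by rewrite trmx_delta map_delta_mx.
  rewrite -(mul_delta_mx (0 : 'I_1)) -E1; apply: (f_rank1 _ 1); rewrite ?oner_neq0 ?rmorph1 //.
  by rewrite E1 mul_delta_mx; apply/matrixP=> a b; rewrite !ord1 !mxE.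
have f_pair c : c * c^* = 1 -> c^* * f (delta_mx k j) + c * f (delta_mx j k) = 0.
  move=> cc.
  pose v : 'cV[K]_n := delta_mx k 0 + c *: delta_mx j 0.
  have vH : v^t* = delta_mx 0 k + c^* *: delta_mx 0 j.
    rewrite /v linearD linearZ /= !trmx_delta map_mxD map_mxZ.
    by rewrite !map_delta_mx.
  have vv : v *m v^t* = delta_mx k k + c^* *: delta_mx k j
                        + (c *: delta_mx j k + delta_mx j j).
    rewrite vH /v mulmxDl !mulmxDr -!scalemxAl -!scalemxAr !mul_delta_mx.
    by rewrite scalerA cc scale1r.
  have vv2 : v^t* *m v = 2%:M.
    rewrite vH /v mulmxDl !mulmxDr -!scalemxAl -!scalemxAr !mul_delta_mx_cond.
    rewrite !eqxx (negPf kj) eq_sym (negPf kj) !mulr0n !mulr1n.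
    rewrite !scaler0 addr0 add0r scalerA [c^* * c]mulrC cc scale1r.
    by apply/matrixP=> a b; rewrite !ord1 !mxE !eqxx.
  have := f_rank1 v 2; rewrite pnatr_eq0 conjC_nat vv vv2 => /(_ erefl erefl erefl).
  by rewrite !fD !fZ !f_diag add0r addr0.
have := f_pair 1; rewrite rmorph1 !mul1r => /(_ erefl) H1.
have := f_pair 'i; rewrite conjCi mulrN -expr2 sqrCi opprK => /(_ erefl).
rewrite mulNr addrC -mulrBr => /eqP; rewrite mulf_eq0 (negPf (neq0Ci _)) /=.
rewrite subr_eq0 => /eqP H2; move: H1; rewrite H2 => /eqP.
by rewrite -mulr2n mulrn_eq0 /= => /eqP.
Qed.

End InfinitesimalInvariance.

(** * The moments of the diagonal, for an abstract invariant functional *)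

Section DiagonalMoments.
Variables (K : numClosedFieldType) (n : nat).
Local Notation B := (mpoly (n * n) K).
Local Notation C := (@mpolyC (n * n) K).
Local Notation mxC := (map_mx (@mpolyC (n * n) K)).
Local Notation X := (generic_mx K n).
Variables (E : {additive B -> K}) (b : 'I_n -> K).
Hypothesis EC : forall c F, E (C c * F) = c * E F.
Hypothesis E1 : E 1 = 1.
Hypothesis E_inv : forall (u : 'M[K]_n) F, u \is unitarymx ->
  E (mx_eval C (mxC u *m X *m mxC (invmx u)) F) = E F.
Hypothesis Echi : forall z F,
  E (\det (X - (C z)%:M) * F) = (\prod_i (b i - z)) * E F.

Definition diag_monomial (a : multinom n) : B := \prod_i X i i ^+ a i.

Local Notation L := (fun a => E (diag_monomial a)).

(** Permutation matrices are unitary. *)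
Lemma diag_moment_sym a (s : 'S_n) : L (mperm a s) = L a.
Proof.
have us : (perm_mx s^-1 : 'M[K]_n) \is unitarymx.
  apply/unitarymxP; rewrite tr_perm_mx map_perm_mx -perm_mxM invgK mulVg.
  by rewrite perm_mx1.
rewrite -[RHS](E_inv _ us); congr (E _).
rewrite /diag_monomial rmorph_prod [LHS](reindex_inj (@perm_inj _ s^-1%g)); apply: eq_bigr => i _ /=.
rewrite rmorphXn /= mx_evalX mnmE permKV; congr (_ ^+ _).
have -> : invmx (perm_mx s^-1) = perm_mx s :> 'M[K]_n.
  by rewrite invmx_unitary // tr_perm_mx map_perm_mx invgK.
rewrite !map_perm_mx -[X in _ *m perm_mx X]invgK -row_permE -col_permE.
by rewrite !mxE.
Qed.

(** Expansion of the determinant; the derivatives of monomials produce the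
falling factorials. *)
Lemma delta_moment_alt a : delta_moment C X E a = alt_moment L a.
Proof.
rewrite /delta_moment /delta_det /determinant raddf_sum.
apply: eq_bigr => s _ /=.
have sgn F : E ((-1) ^+ s * F) = (-1) ^+ s * E F.
  by case: (odd_perm s); rewrite ?expr1 ?expr0 ?mulN1r ?mul1r ?raddfN.
rewrite sgn; congr (_ * _); rewrite -EC; congr (E _).
rewrite natr_prod rmorph_prod -big_split; apply: eq_bigr => i _ /=.
rewrite mxE derivnXn ev_diagMn mnmBE mnmE mpolyC_nat mulr_natl; congr (_ *+ _).
by rewrite /ev_diag map_polyXn hornerXn.
Qed.

Theorem diag_moment_expansion eta :
  L eta = \sum_(lam : bmultinom n (mdeg eta).+1 |
                is_partition lam && (mdeg lam == mdeg eta))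
    ((mfact (delta n))%:R * (mfact eta)%:R) / (mfact (mnm_add lam (delta n)))%:R
      * (kostka lam eta)%:R * meval b (tableau_schur K lam).
Proof.
have DX k j a c : mx_derivation (commutator_mx (delta_mx k j)) (X a c) =
    (a == k)%:R * X j c - X a k * (c == j)%:R.
  rewrite mx_derivationX /commutator_mx !mxE; congr (_ - _).
    rewrite (bigD1 j) //= !mxE eqxx andbT big1 ?addr0 => [|i ij].
      by rewrite mpolyC_nat.
    by rewrite !mxE (negPf ij) andbF mpolyC0 mul0r.
  rewrite (bigD1 k) //= !mxE eqxx /= big1 ?addr0 => [|i ik].
    by rewrite mpolyC_nat.
  by rewrite !mxE (negPf ik) mpolyC0 mulr0.
have Lmul p g : p \is symmetric ->
    mpoly_lin (alt_moment L) (p * g) = meval b p * mpoly_lin (alt_moment L) g.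
  move=> psym.
  have lin_eq q : mpoly_lin (alt_moment L) q = mpoly_lin (delta_moment C X E) q.
    by apply: eq_bigr => m _; rewrite delta_moment_alt.
  rewrite !lin_eq.
  apply: (delta_moment_symmetric
    (D := fun k j => mx_derivation (commutator_mx (delta_mx k j)))) => //.
  - by move=> k j p' q'; exact: mx_derivationM.
  - by move=> k j c; exact: mx_derivationC.
  by move=> k j F kj; exact: E_commutator_derivation.
rewrite (moment_expansion (S := @tableau_schur K n) diag_moment_sym _ Lmul) //.
- by apply: eq_bigr => lam _; rewrite mcoeff_tableau_schur.
- by rewrite /diag_monomial big1 // => i _; rewrite mnm0E.
- by move=> lam; exact: tableau_schur_alt.
Qed.

End DiagonalMoments.

(** * Unitary orbits of real diagonal matrices *)

Lemma invmx_mul (K : comUnitRingType) n (u v : 'M[K]_n) :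
  u \in unitmx -> v \in unitmx -> invmx (u *m v) = invmx v *m invmx u.
Proof.
move=> uu uv; have uvK : u *m v *m (invmx v *m invmx u) = 1%:M.
  by rewrite mulmxA mulmxK // mulmxV.
have [uvu _] := mulmx1_unit uvK.
by rewrite -[RHS]mul1mx -(mulVmx uvu) -mulmxA uvK mulmx1.
Qed.

Section UnitaryOrbit.
Local Open Scope sesquilinear_scope.
Variables (K : numClosedFieldType) (n : nat) (d : 'rV[K]_n).
Hypothesis dR : forall i, (d 0 i)^* = d 0 i.

Definition in_unitary_orbit (X : 'M[K]_n) : Prop :=
  exists2 u : 'M[K]_n, u \is unitarymx & u *m diag_mx d *m invmx u = X.

Let diag_conj : (diag_mx d)^t* = diag_mx d.
Proof.
apply/matrixP=> i j; rewrite !mxE eq_sym; case: eqP => [->|_].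
  by rewrite !mulr1n dR.
by rewrite !mulr0n conjC0.
Qed.

Lemma unitary_orbit_conj u X : u \is unitarymx ->
  in_unitary_orbit X -> in_unitary_orbit (u *m X *m invmx u).
Proof.
move=> uu [v vu <-]; exists (u *m v); first exact: mul_unitarymx.
by rewrite invmx_mul ?unitarymx_unit // !mulmxA.
Qed.

Lemma orbit_hermitian X : in_unitary_orbit X -> X^t* = X.
Proof.
case=> u uu <-; rewrite (invmx_unitary uu) !trmx_mul !map_mxM.
by rewrite -[((diag_mx d)^T ^ _)%sesqui]/((diag_mx d)^t*) diag_conj
  -[((u ^t*)^T ^ _)%sesqui]/(u^t*^t*) trmxCK mulmxA.
Qed.

Lemma orbit_det X z : in_unitary_orbit X ->
  \det (X - z%:M) = \prod_i (d 0 i - z).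
Proof.
case=> u /unitarymx_unit uu <-.
have -> : u *m diag_mx d *m invmx u - z%:M =
          u *m (diag_mx d - z%:M) *m invmx u.
  rewrite mulmxBr mulmxBl; congr (_ - _).
  by rewrite scalar_mxC -mulmxA mulmxV // mulmx1.
rewrite !det_mulmx mulrAC -det_mulmx mulmxV // det1 mul1r.
have -> : diag_mx d - z%:M = diag_mx (\row_i (d 0 i - z)).
  apply/matrixP=> i j; rewrite !mxE; case: eqP => [->|_].
    by rewrite !mulr1n.
  by rewrite !mulr0n subr0.
by rewrite det_diag; apply: eq_bigr => i _; rewrite mxE.
Qed.

(** The Hilbert-Schmidt norm is the trace of X X^*, which for Hermitian X is
the trace of X^2. *)
Lemma orbit_norm X : in_unitary_orbit X ->
  \sum_i \sum_j X i j * (X i j)^* = \sum_i d 0 i * (d 0 i)^*.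
Proof.
move=> OX; have trE (M : 'M[K]_n) :
    \sum_i \sum_j M i j * (M i j)^* = \tr (M *m M^t*).
  by apply: eq_bigr => i _; rewrite mxE; apply: eq_bigr => j _; rewrite !mxE.
rewrite trE (orbit_hermitian OX); case: OX => u /unitarymx_unit uu <-.
rewrite !mulmxA mulmxKV // mxtrace_mulC !mulmxA mulVmx // mul1mx.
rewrite /mxtrace; apply: eq_bigr => i _.
rewrite mul_diag_mx !mxE eqxx mulr1n dR //.
Qed.

(** By the spectral theorem X is unitarily diagonalizable, and its
characteristic polynomial, being determined by its values at infinitely many
points, gives the eigenvalues d up to a permutation. Countably many conditions
suffice, as needed for measurability. *)
Lemma orbit_characterization X : X^t* = X ->
  (forall m : nat, \det (X - (m%:R)%:M) = \prod_i (d 0 i - m%:R)) ->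
  in_unitary_orbit X.
Proof.
move=> XH Xdet.
have /orthomx_spectralP XE : X \is normalmx by apply/normalmxP; rewrite XH.
set P := spectralmx X in XE; set sp := spectral_diag X in XE.
have Pu : P \is unitarymx := spectral_unitarymx X.
have spdet m : \prod_i (sp 0 i - m%:R) = \prod_i (d 0 i - m%:R) :> K.
  rewrite -Xdet [in RHS]XE.
  have -> : invmx P *m diag_mx sp *m P - (m%:R)%:M =
            invmx P *m (diag_mx sp - (m%:R)%:M) *m P.
    rewrite mulmxBr mulmxBl; congr (_ - _).
    by rewrite scalar_mxC -mulmxA mulVmx ?mulmx1 // unitarymx_unit.
  rewrite !det_mulmx mulrAC -det_mulmx mulVmx ?unitarymx_unit // det1 mul1r.
  have -> : diag_mx sp - (m%:R)%:M = diag_mx (\row_i (sp 0 i - m%:R)).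
    apply/matrixP=> i j; rewrite !mxE; case: eqP => [->|_].
      by rewrite !mulr1n.
    by rewrite !mulr0n subr0.
  by rewrite det_diag; apply: eq_bigr => i _; rewrite mxE.
pose ts := [tuple sp 0 i | i < n]; pose td := [tuple d 0 i | i < n].
have /prod_XsubC_eq/tuple_permP[s tsE] :
    \prod_(x <- ts) ('X - x%:P) = \prod_(x <- td) ('X - x%:P).
  apply/eqP; rewrite -subr_eq0; apply/eqP.
  apply: (poly_eq0_nat) => m; rewrite hornerD hornerN !horner_prod !big_tuple.
  under eq_bigr do rewrite hornerXsubC tnth_mktuple.
  under [X in _ - X]eq_bigr do rewrite hornerXsubC tnth_mktuple.
  by rewrite !prod_subC spdet subrr.
have spE i : sp 0 i = d 0 (s i).
  have := congr1 (fun t => nth 0 t i) tsE.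
  by rewrite -!tnth_nth !tnth_mktuple.
have sp_perm : diag_mx sp = perm_mx s *m diag_mx d *m invmx (perm_mx s).
  have us : (perm_mx s : 'M[K]_n) \in unitmx by exact: unitmx_perm.
  apply: (canRL (mulmxK us)); apply/matrixP=> i j.
  rewrite -row_permE mul_diag_mx !mxE spE.
  by rewrite mulr_natr.
have Vu : invmx P \is unitarymx by rewrite invmx_unitary // trmxC_unitary.
have su : (perm_mx s : 'M[K]_n) \is unitarymx.
  by apply/unitarymxP; rewrite tr_perm_mx map_perm_mx -perm_mxM mulgV perm_mx1.
exists (invmx P *m perm_mx s); first exact: mul_unitarymx.
by rewrite invmx_mul ?unitarymx_unit // invmxK [RHS]XE sp_perm !mulmxA.
Qed.

End UnitaryOrbit.

(** * Measurable complex functions on matrices *)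

Section ComplexValuedFunctions.
Local Open Scope classical_set_scope.
Variables (R : realType) (n : nat).
Local Notation C := (R[i]%C : numClosedFieldType).
Local Notation T := (borel_cmx R n).
Local Notation M := 'M[C]_n.
Local Notation Re := (@complex.Re R).
Local Notation Im := (@complex.Im R).

Lemma ReD (x y : R[i]) : Re (x + y) = Re x + Re y. Proof. by case: x; case: y. Qed.
Lemma ImD (x y : R[i]) : Im (x + y) = Im x + Im y. Proof. by case: x; case: y. Qed.
Lemma ReN (x : R[i]) : Re (- x) = - Re x. Proof. by case: x. Qed.
Lemma ImN (x : R[i]) : Im (- x) = - Im x. Proof. by case: x. Qed.
Lemma ReM (x y : R[i]) : Re (x * y) = Re x * Re y - Im x * Im y.
Proof. by case: x; case: y. Qed.
Lemma ReMn (x : R[i]) m : Re (x *+ m) = Re x *+ m.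
Proof. by elim: m => [|m IH] //; rewrite !mulrS ReD IH. Qed.
Lemma ImM (x y : R[i]) : Im (x * y) = Re x * Im y + Im x * Re y.
Proof. by case: x => a b; case: y => c d; rewrite /= [RHS]addrC addrC. Qed.

Lemma complex_ext (x y : R[i]) : Re x = Re y -> Im x = Im y -> x = y.
Proof. by case: x => a b; case: y => c d /= -> ->. Qed.

Lemma lipschitz_continuous (f : C -> R) :
  (forall z t : C, ((`|f z - f t|)%:C)%C <= `|z - t|) -> continuous f.
Proof.
move=> lip z A /nbhs_ballP[e /= e0 sA].
exists (e%:C)%C; first by rewrite /= ltcR.
move=> t /= zt; apply: sA; rewrite /ball /=.
by rewrite -ltcR; apply: le_lt_trans (lip _ _) zt.
Qed.

Lemma Re_continuous : continuous (Re : C -> R).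
Proof.
apply: lipschitz_continuous => z t.
by have := normc_ge_Re (z - t); case: z; case: t.
Qed.

Lemma Im_continuous : continuous (Im : C -> R).
Proof.
apply: lipschitz_continuous => z t.
case: z t => [a b] [c d]; rewrite normc_def lecR /= -sqrtr_sqr ler_wsqrtr //.
by rewrite lerDr sqr_ge0.
Qed.

(** The Borel sets of matrices are generated by the open sets of the product
topology, for which entries are continuous. *)
Lemma measurable_continuous_entry (f : C -> R) i j : continuous f ->
  measurable_fun setT (fun X : T => f (X i j)).
Proof.
move=> cf; apply: (measurability _ (RGenOInfty.measurableE R)) => _ [_ [x ->] <-].
rewrite setTI; apply: sub_sigma_algebra.
apply: (@open_comp M R (fun X => f (X i j))); last exact: interval_open.
by move=> X _; apply: continuous_comp; [exact: coord_continuous | exact: cf].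
Qed.

Definition cmeasurable (f : T -> R[i]) : Prop :=
  measurable_fun setT (Re \o f) /\ measurable_fun setT (Im \o f).

Definition cbounded_on (O : set T) (f : T -> R[i]) : Prop :=
  exists B : R, forall X, O X -> `|Re (f X)| <= B /\ `|Im (f X)| <= B.

Lemma cmeasurable_eq0 f : cmeasurable f -> measurable [set X | f X = 0].
Proof.
case=> mR mI.
have -> : [set X | f X = 0] =
    (Re \o f) @^-1` [set 0] `&` (Im \o f) @^-1` [set 0].
  apply/seteqP; split=> X /=; first by move=> ->.
  by case=> h1 h2; apply: complex_ext.
rewrite -[X in X `&` _]setTI -[X in _ `&` X]setTI.
by apply: measurableI; [apply: mR | apply: mI].
Qed.

Section Class.
Variable O : set T.

(** These functions form an algebra that contains the polynomials, and on a
set of full measure O they are integrable. *)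
Definition bmeas (f : T -> R[i]) : Prop := cmeasurable f /\ cbounded_on O f.

Lemma bmeas_cst c : bmeas (fun=> c).
Proof.
split; first by split; exact: measurable_cst.
by exists (`|Re c| + `|Im c|) => X _; rewrite lerDl lerDr !normr_ge0.
Qed.

Lemma bmeasD f g : bmeas f -> bmeas g -> bmeas (fun X => f X + g X).
Proof.
move=> [[fR fI] [B fB]] [[gR gI] [B' gB]]; split; first split.
- rewrite (_ : _ \o _ = (Re \o f) \+ (Re \o g)); first exact: measurable_funD.
  by apply/funext => X /=; rewrite ReD.
- rewrite (_ : _ \o _ = (Im \o f) \+ (Im \o g)); first exact: measurable_funD.
  by apply/funext => X /=; rewrite ImD.
exists (B + B') => X OX; have [? ?] := fB X OX; have [? ?] := gB X OX.
by rewrite ReD ImD; split; apply: le_trans (ler_normD _ _) _; apply: lerD.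
Qed.

Lemma bmeasM f g : bmeas f -> bmeas g -> bmeas (fun X => f X * g X).
Proof.
move=> [[fR fI] [B fB]] [[gR gI] [B' gB]]; split; first split.
- rewrite (_ : _ \o _ = ((Re \o f) \* (Re \o g)) \- ((Im \o f) \* (Im \o g))).
    by apply: measurable_funB; apply: measurable_funM.
  by apply/funext => X /=; rewrite ReM.
- rewrite (_ : _ \o _ = ((Re \o f) \* (Im \o g)) \+ ((Im \o f) \* (Re \o g))).
    by apply: measurable_funD; apply: measurable_funM.
  by apply/funext => X /=; rewrite ImM.
exists (B * B' + B * B') => X OX; have [? ?] := fB X OX; have [? ?] := gB X OX.
rewrite ReM ImM; split.
  apply: le_trans (ler_normB _ _) _.
  by rewrite !normrM; apply: lerD; apply: ler_pM.
apply: le_trans (ler_normD _ _) _.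
by rewrite !normrM; apply: lerD; apply: ler_pM.
Qed.

Lemma bmeas_sum (I : Type) (s : seq I) (f : I -> T -> R[i]) :
  (forall k, bmeas (f k)) -> bmeas (fun X => \sum_(k <- s) f k X).
Proof.
move=> gf; elim: s => [|k s IH].
  by under eq_fun do rewrite big_nil; apply: bmeas_cst.
by under eq_fun do rewrite big_cons; apply: bmeasD.
Qed.

Lemma bmeas_prod (I : Type) (s : seq I) (f : I -> T -> R[i]) :
  (forall k, bmeas (f k)) -> bmeas (fun X => \prod_(k <- s) f k X).
Proof.
move=> gf; elim: s => [|k s IH].
  by under eq_fun do rewrite big_nil; apply: bmeas_cst.
by under eq_fun do rewrite big_cons; apply: bmeasM.
Qed.

Lemma bmeas_exp f m : bmeas f -> bmeas (fun X => f X ^+ m).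
Proof.
move=> gf; elim: m => [|m IH]; first exact: bmeas_cst.
by under eq_fun do rewrite exprS; apply: bmeasM.
Qed.

Hypothesis entry_bounded : forall i j, cbounded_on O (fun X => X i j).

Lemma bmeas_entry i j : bmeas (fun X => X i j).
Proof.
split=> //; split; apply: measurable_continuous_entry.
  exact: Re_continuous.
exact: Im_continuous.
Qed.

Lemma bmeas_mx_eval (F : mpoly (n * n) R[i]) :
  bmeas (fun X : T => mx_eval idfun (X : M) F).
Proof.
apply: bmeas_sum => m; apply: bmeasM; first exact: bmeas_cst.
apply: bmeas_prod => t; apply: bmeas_exp.
by case/mxvec_indexP: t => i j; under eq_fun do rewrite mxvecE; apply: bmeas_entry.
Qed.

End Class.

End ComplexValuedFunctions.

(** * The orbit integral of polynomials *)

Section OrbitMeasurable.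
Local Open Scope classical_set_scope.
Local Open Scope sesquilinear_scope.
Variables (R : realType) (n : nat) (b : n.-tuple R).
Local Notation C := (R[i]%C : numClosedFieldType).
Local Notation T := (borel_cmx R n).
Local Notation M := 'M[C]_n.
Local Notation Re := (@complex.Re R).
Local Notation Im := (@complex.Im R).

Local Notation d := (\row_i ((tnth b i)%:C)%C : 'rV[C]_n).

Lemma orbit_diag_real i : (d 0 i)^* = d 0 i.
Proof. by rewrite mxE; apply: complex_ext => //=; rewrite oppr0. Qed.

Lemma unitary_orbitP (X : T) : unitary_orbit b X <-> in_unitary_orbit d (X : M).
Proof. by split. Qed.

Lemma bmeas_conj (O : set T) f : bmeas O f -> bmeas O (fun X => (f X)^*%C).
Proof.
move=> [[fR fI] [B fB]]; split; first split.
- by apply: eq_measurable_fun fR => X _ /=; case: (f X).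
- apply: (eq_measurable_fun (\- (Im \o f))); last exact: measurable_funN.
  by move=> X _ /=; case: (f X).
exists B => X OX; have [] := fB X OX.
by case: (f X) => x y /=; rewrite normrN.
Qed.

Lemma mx_eval_char_poly (X : M) (z : C) :
  mx_eval idfun X (\det (generic_mx C n - (mpolyC (n * n) z)%:M)) =
  \det (X - z%:M).
Proof.
rewrite -det_map_mx; congr (\det _); apply/matrixP=> i j.
rewrite [LHS]mxE [X in GRing.RMorphism.sort _ X]mxE rmorphD /= mx_evalX [RHS]mxE.
by congr (_ + _); rewrite !mxE rmorphN rmorphMn /= mx_evalC.
Qed.

(** The conditions of [orbit_characterization] are countably many equations
between Borel functions. *)
Lemma measurable_unitary_orbit : measurable (unitary_orbit b).
Proof.
have bd0 i j : cbounded_on (set0 : set T) (fun X => X i j) by exists 0.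
have -> : unitary_orbit b =
   (\bigcap_(p : 'I_n * 'I_n) [set X : T | X p.1 p.2 - ((X p.2 p.1)^*)%C = 0])
   `&` \bigcap_(m : nat)
         [set X : T | mx_eval idfun (X : M) (\det (generic_mx C n -
                      (mpolyC (n * n) m%:R)%:M)) - \prod_i (d 0 i - m%:R) = 0].
  apply/seteqP; split=> [X /unitary_orbitP OX|X [Xh Xd]].
    split=> [[i j] _|m _] /=.
      have /matrixP/(_ i j) := orbit_hermitian orbit_diag_real OX.
      by rewrite !mxE => <-; exact: subrr.
    by rewrite mx_eval_char_poly (orbit_det _ OX) subrr.
  apply/unitary_orbitP/orbit_characterization => [|m].
    apply/matrixP=> i j; rewrite !mxE.
    by apply/esym/eqP; rewrite -subr_eq0; apply/eqP; exact: (Xh (i, j)).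
  by rewrite -mx_eval_char_poly; apply/eqP; rewrite -subr_eq0; apply/eqP; exact: Xd.
apply: measurableI.
  apply: fin_bigcap_measurable; first exact: finite_finset.
  move=> [i j] _; apply: cmeasurable_eq0.
  have gX k l : bmeas set0 (fun X : T => X k l) by exact: bmeas_entry.
  rewrite /=; have [//] : bmeas set0 (fun X : T => X i j + -1 * ((X j i)^*)%C).
    by apply: bmeasD => //; apply: bmeasM; [exact: bmeas_cst | exact: bmeas_conj].
  by under eq_fun do rewrite mulN1r.
apply: bigcapT_measurable => m; apply: cmeasurable_eq0.
by have [] := bmeasD (bmeas_mx_eval bd0 (\det (generic_mx C n -
  (mpolyC (n * n) m%:R)%:M))) (bmeas_cst set0 (- \prod_i (d 0 i - m%:R))).
Qed.

(** The Hilbert-Schmidt norm is constant on the orbit. *)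
Lemma orbit_entry_bounded i j :
  cbounded_on (unitary_orbit b) (fun X => X i j).
Proof.
exists (Num.sqrt (\sum_i (tnth b i) ^+ 2)) => X /unitary_orbitP OX.
have /(congr1 Re) := orbit_norm orbit_diag_real OX.
have ReS (I : finType) (F : I -> R[i]) : Re (\sum_i F i) = \sum_i Re (F i).
  by apply: (big_morph Re) => //; exact: ReD.
have sqE (z : R[i]) : Re (z * (z^*)%C) = Re z ^+ 2 + Im z ^+ 2.
  by case: z => x y /=; rewrite mulrN opprK !expr2.
rewrite !ReS; under eq_bigr do rewrite ReS.
under [RHS]eq_bigr do rewrite mxE sqE /= expr0n addr0.
move=> nE; rewrite -nE.
have le : Re (X i j) ^+ 2 + Im (X i j) ^+ 2 <=
    \sum_i \sum_j Re (X i j * ((X i j)^*)%C).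
  have ge0 k l : 0 <= Re (X k l * ((X k l)^*)%C).
    by rewrite sqE addr_ge0 ?sqr_ge0.
  rewrite (bigD1 i) //= (bigD1 j) //= sqE -addrA lerDl addr_ge0 //.
    by rewrite sumr_ge0.
  by rewrite sumr_ge0 // => k _; rewrite sumr_ge0.
by split; rewrite -sqrtr_sqr ler_wsqrtr //; apply: le_trans le;
   rewrite ?lerDl ?lerDr sqr_ge0.
Qed.

End OrbitMeasurable.

Section OrbitExpectation.
Local Open Scope classical_set_scope.
Variables (R : realType) (n : nat) (b : n.-tuple R).
Variable nu : probability (borel_cmx R n) R.
Hypothesis nuP : invariant_orbit_probability b nu.
Local Notation C := (R[i]%C : numClosedFieldType).
Local Notation T := (borel_cmx R n).
Local Notation M := 'M[C]_n.
Local Notation Re := (@complex.Re R).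
Local Notation Im := (@complex.Im R).
Local Notation B := (mpoly (n * n) R[i]).
Local Notation O := (unitary_orbit b).
Local Notation bm := (bmeas O).

Lemma orbit_compl_null : nu (~` O) = 0%E.
Proof.
rewrite probability_setC; last exact: measurable_unitary_orbit.
by case: nuP => -> _; rewrite subee.
Qed.

Lemma orbit_bounded_integrable_on (f : T -> R) : measurable_fun setT f ->
  (exists B, forall X, O X -> `|f X| <= B) ->
  nu.-integrable O (EFin \o f).
Proof.
move=> mf [B fB]; apply: measurable_bounded_integrable.
- exact: measurable_unitary_orbit.
- by case: nuP => nuO _; rewrite [X in (X < _)%E]nuO ltry.
- exact: measurable_funTS.
exists B; split; first exact: num_real.
by move=> x Bx X OX; apply: le_trans (fB _ OX) (ltW Bx).
Qed.

Lemma orbit_bounded_integrable (f : T -> R) : measurable_fun setT f ->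
  (exists B, forall X, O X -> `|f X| <= B) ->
  nu.-integrable setT (EFin \o f).
Proof.
move=> mf fB.
have mO := measurable_unitary_orbit b.
have := @negligible_integrable _ _ _ nu setT (~` O) (EFin \o f).
rewrite setDE setCK setTI => h; apply/h => //.
- exact: measurableC.
- exact/measurable_EFinP.
- exact: orbit_compl_null.
exact: orbit_bounded_integrable_on.
Qed.

Lemma Rintegral_orbit (f : T -> R) : measurable_fun setT f ->
  (exists B, forall X, O X -> `|f X| <= B) ->
  Rintegral nu setT f = Rintegral nu O f.
Proof.
move=> mf fB; have mO := measurable_unitary_orbit b; rewrite /Rintegral.
rewrite (@negligible_integral _ _ _ nu setT (~` O)) //.
- by rewrite setDE setCK setTI.
- exact: measurableC.
- exact: orbit_bounded_integrable.
exact: orbit_compl_null.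
Qed.

(** Integrating over the orbit instead of all matrices makes the functions
that agree on the orbit indistinguishable. *)
Definition cexpect (f : T -> R[i]) : R[i] :=
  Complex (Rintegral nu O (Re \o f)) (Rintegral nu O (Im \o f)).

Lemma bmeas_Re f : bm f -> nu.-integrable O (EFin \o (Re \o f)).
Proof.
by case=> [[mR mI] [B fB]]; apply: orbit_bounded_integrable_on => //;
   exists B => X /fB[].
Qed.

Lemma bmeas_Im f : bm f -> nu.-integrable O (EFin \o (Im \o f)).
Proof.
by case=> [[mR mI] [B fB]]; apply: orbit_bounded_integrable_on => //;
   exists B => X /fB[].
Qed.

Lemma eq_cexpect f g : (forall X, O X -> f X = g X) -> cexpect f = cexpect g.
Proof.
by move=> fg; congr Complex; apply: eq_Rintegral => X /set_mem OX /=;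
   rewrite fg.
Qed.

Lemma cexpectB f g : bm f -> bm g ->
  cexpect (fun X => f X - g X) = cexpect f - cexpect g.
Proof.
have mO := measurable_unitary_orbit b.
move=> gf gg; congr Complex.
  rewrite -RintegralB //; [|exact: bmeas_Re..].
  by apply: eq_Rintegral => X _ /=; rewrite ReD ReN.
rewrite -RintegralB //; [|exact: bmeas_Im..].
by apply: eq_Rintegral => X _ /=; rewrite ImD ImN.
Qed.

Lemma cexpectZ c f : bm f -> cexpect (fun X => c * f X) = c * cexpect f.
Proof.
have mO := measurable_unitary_orbit b.
move=> gf; have iR := bmeas_Re gf; have iI := bmeas_Im gf.
have iZ a g : nu.-integrable O (EFin \o g) ->
    nu.-integrable O (EFin \o (fun X => a * g X)).
  by move=> ig; exact: (integrableZl mO a ig).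
apply: complex_ext; rewrite ?ReM ?ImM /cexpect /=.
  rewrite -!RintegralZl // -RintegralB //; [|exact: iZ..].
  by apply: eq_Rintegral => X _ /=; rewrite ReM.
rewrite -!RintegralZl // -RintegralD //; [|exact: iZ..].
by apply: eq_Rintegral => X _ /=; rewrite ImM.
Qed.

Lemma cexpect1 : cexpect (fun=> 1) = 1.
Proof.
have mO := measurable_unitary_orbit b; case: nuP => nuO _.
rewrite /cexpect (@eq_Rintegral _ _ _ nu O (fun=> 1)) //.
rewrite [X in Complex _ X](@eq_Rintegral _ _ _ nu O (fun=> 0)) //.
by rewrite !Rintegral_cst // [X in fine X]nuO mul0r mulr1.
Qed.

Lemma orbit_unitary_conj (u : M) X : u \is unitarymx ->
  O X -> O (unitary_conj u X).
Proof.
by move=> uu /unitary_orbitP OX; apply/unitary_orbitP/unitary_orbit_conj.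
Qed.

(** Both integrals are over the line, for the images of nu under f and fu;
these two measures have the same values by the invariance of nu. Passing to
the line avoids the measurability of conjugation. *)
Lemma Rintegral_unitary_conj (u : M) (f : T -> R) : u \is unitarymx ->
  let fu : T -> R := fun X => f (unitary_conj u X) in
  measurable_fun setT f -> measurable_fun setT fu ->
  (exists B, forall X, O X -> `|f X| <= B) ->
  Rintegral nu O fu = Rintegral nu O f.
Proof.
move=> uu fu mf mfu fB.
have fuB : exists B, forall X, O X -> `|fu X| <= B.
  by case: fB => B fB; exists B => Y OY; apply/fB/orbit_unitary_conj.
have push (g : T -> R) : measurable_fun setT g ->
    (exists B, forall X, O X -> `|g X| <= B) ->
    (\int[nu]_x (g x)%:E = \int[pushforward nu g]_y y%:E)%E.
  move=> mg gB; rewrite integral_pushforward //.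
  exact: orbit_bounded_integrable.
rewrite -!Rintegral_orbit // /Rintegral !push //; congr fine.
apply: eq_measure_integral => A mA _ /=.
rewrite /pushforward; case: nuP => _ inv; apply: (inv u (f @^-1` A)) => //.
by rewrite -[X in measurable X]setTI; apply: mf.
Qed.

Lemma cexpect_unitary_conj (u : M) (f : T -> R[i]) : u \is unitarymx ->
  bm f -> bm (fun X : T => f (unitary_conj u X)) ->
  cexpect (fun X : T => f (unitary_conj u X)) = cexpect f.
Proof.
move=> uu [[fR fI] [B fB]] [[fuR fuI] _].
by congr Complex; apply: (Rintegral_unitary_conj uu) => //;
   exists B => X /fB[].
Qed.

End OrbitExpectation.

Section OrbitMoments.
Local Open Scope classical_set_scope.
Variables (R : realType) (n : nat) (b : n.-tuple R).
Variable nu : probability (borel_cmx R n) R.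
Hypothesis nuP : invariant_orbit_probability b nu.
Local Notation C := (R[i]%C : numClosedFieldType).
Local Notation T := (borel_cmx R n).
Local Notation M := 'M[C]_n.
Local Notation Re := (@complex.Re R).
Local Notation Im := (@complex.Im R).
Local Notation pC := (@mpolyC (n * n) C).
Local Notation X := (generic_mx C n).
Local Notation O := (unitary_orbit b).
Local Notation ev F := (fun Y : T => mx_eval idfun (Y : M) F).

Definition poly_expect (F : mpoly (n * n) C) : C := cexpect b nu (ev F).

Lemma bmeas_ev F : bmeas O (ev F).
Proof. by apply: bmeas_mx_eval => i j; exact: orbit_entry_bounded. Qed.

Lemma poly_expect_is_additive : zmod_morphism poly_expect.
Proof.
move=> F G; rewrite /poly_expect -(cexpectB nuP (bmeas_ev F) (bmeas_ev G)).
by apply: eq_cexpect => Y _; rewrite rmorphB.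
Qed.

HB.instance Definition _ := GRing.isZmodMorphism.Build
  (mpoly (n * n) C) C poly_expect poly_expect_is_additive.

Lemma poly_expectZ c F : poly_expect (pC c * F) = c * poly_expect F.
Proof.
rewrite /poly_expect -(cexpectZ nuP c (bmeas_ev F)).
by apply: eq_cexpect => Y _; rewrite rmorphM /= mx_evalC.
Qed.

Lemma poly_expect1 : poly_expect 1 = 1.
Proof.
rewrite -(cexpect1 nuP); apply: eq_cexpect => Y _.
by rewrite rmorph1.
Qed.

Lemma poly_expect_char_poly z F :
  poly_expect (\det (X - (pC z)%:M) * F) =
  (\prod_i ((tnth b i)%:C%C - z)) * poly_expect F.
Proof.
rewrite /poly_expect -(cexpectZ nuP _ (bmeas_ev F)).
apply: eq_cexpect => Y /unitary_orbitP OY.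
rewrite rmorphM /= mx_eval_char_poly (orbit_det z OY).
by congr (_ * _); apply: eq_bigr => i _; rewrite mxE.
Qed.

Lemma poly_expect_conj (u : M) F : u \is unitarymx ->
  poly_expect (mx_eval pC (map_mx pC u *m X *m map_mx pC (invmx u)) F) =
  poly_expect F.
Proof.
move=> uu; rewrite /poly_expect; set G := mx_eval pC _ F.
have evG : ev G = fun Y : T => ev F (unitary_conj u Y).
  apply/funext => Y; rewrite /G mx_eval_comp /unitary_conj !map_mxM.
  rewrite (@eq_mx_eval _ _ _ _ idfun) => [|c]; last by rewrite /= mx_evalC.
  congr (mx_eval _ _ F); congr (_ *m _ *m _); apply/matrixP=> i j.
  - by rewrite !mxE /= mx_evalC.
  - by rewrite [LHS]mxE /= mx_evalX.
  by rewrite !mxE /= mx_evalC.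
have gu : bmeas O (fun Y : T => ev F (unitary_conj u Y)).
  by rewrite -evG; exact: bmeas_ev.
by rewrite evG; exact: (cexpect_unitary_conj nuP uu (bmeas_ev F) gu).
Qed.

Lemma diag_moment_complex eta :
  poly_expect (diag_monomial C eta) =
  \sum_(lam : bmultinom n (mdeg eta).+1 |
                is_partition lam && (mdeg lam == mdeg eta))
    ((mfact (delta n))%:R * (mfact eta)%:R) / (mfact (mnm_add lam (delta n)))%:R
      * (kostka lam eta)%:R
      * meval (fun i => ((tnth b i)%:C)%C) (tableau_schur C lam).
Proof.
apply: (diag_moment_expansion poly_expectZ poly_expect1).
- by move=> u F; exact: poly_expect_conj.
exact: poly_expect_char_poly.
Qed.

End OrbitMoments.

(** * Moments of the projection to the diagonal *)

Section DiagonalMeasure.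
Local Open Scope classical_set_scope.
Variables (R : realType) (n : nat) (b : n.-tuple R).
Variable nu : probability (borel_cmx R n) R.
Hypothesis nuP : invariant_orbit_probability b nu.
Local Notation C := (R[i]%C : numClosedFieldType).
Local Notation T := (borel_cmx R n).
Local Notation M := 'M[C]_n.
Local Notation Re := (@complex.Re R).
Local Notation pC := (@mpolyC (n * n) C).
Local Notation X := (generic_mx C n).
Local Notation O := (unitary_orbit b).

Definition diag_lift (p : mpoly n R) : mpoly (n * n) C :=
  mmap (pC \o real_complex R) (fun i => X i i) p.

Lemma diag_lift_monomial mu : diag_lift (mpolyX R mu) = diag_monomial C mu.
Proof. by rewrite /diag_lift mmapX. Qed.

Lemma complex_meval (v : 'I_n -> R) (p : mpoly n R) :
  ((meval v p)%:C)%C =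
  \sum_(m <- msupp p) ((mcoeff m p)%:C)%C * \prod_i ((v i)%:C)%C ^+ m i.
Proof.
rewrite /meval /mmap [LHS](raddf_sum (real_complex R)); apply: eq_bigr => m _.
rewrite [LHS](rmorphM (real_complex R)).
rewrite [X in _ * X](rmorph_prod (real_complex R)).
by congr (_ * _); apply: eq_bigr => i _; rewrite (rmorphXn (real_complex R)).
Qed.

(** The diagonal entries of a Hermitian matrix are real, so taking real parts
does not change them. *)
Lemma eval_diag_lift (Y : T) p : O Y ->
  mx_eval idfun (Y : M) (diag_lift p) = ((meval (tnth (diag_proj Y)) p)%:C)%C.
Proof.
move=> /unitary_orbitP OY.
have YE i : Y i i = ((tnth (diag_proj Y) i)%:C)%C.
  have /matrixP/(_ i i) := orbit_hermitian (orbit_diag_real b) OY.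
  rewrite !mxE tnth_mktuple => YH; apply: complex_ext => //=.
  have /(congr1 (@complex.Im R)) : ((Y i i)^*)%C = Y i i by [].
  by case: (Y i i) => x y /= /eqP; rewrite eq_sym -addr_eq0 -mulr2n mulrn_eq0 /= => /eqP.
rewrite complex_meval /diag_lift /mmap raddf_sum.
apply: eq_bigr => m _ /=; rewrite rmorphM /= mx_evalC rmorph_prod.
by congr (_ * _); apply: eq_bigr => i _; rewrite rmorphXn /= mx_evalX YE.
Qed.

Lemma bmeas_diag_proj p :
  bmeas O (fun Y => ((meval (tnth (diag_proj Y)) p)%:C)%C).
Proof.
have -> : (fun Y : T => ((meval (tnth (diag_proj Y)) p)%:C)%C) = fun Y : T =>
    \sum_(m <- msupp p) ((mcoeff m p)%:C)%C *
      \prod_i ((tnth (diag_proj Y) i)%:C)%C ^+ m i.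
  by apply/funext => Y; rewrite complex_meval.
apply: bmeas_sum => m; apply: bmeasM; first exact: bmeas_cst.
apply: bmeas_prod => i; apply: bmeas_exp.
have [[eR eI] [B0 eB]] := bmeas_entry (@orbit_entry_bounded R n b) i i.
split; first split.
- by apply: eq_measurable_fun eR => Y _ /=; rewrite tnth_mktuple.
- exact: measurable_cst.
exists B0 => Y /eB[h h'] /=; rewrite tnth_mktuple normr0; split=> //.
exact: le_trans h.
Qed.

Lemma measurable_diag_proj : measurable_fun setT (@diag_proj R n).
Proof.
apply/measurable_fun_tnthP => i.
have [[eR _] _] := bmeas_entry (@orbit_entry_bounded R n b) i i.
by apply: eq_measurable_fun eR => Y _ /=; rewrite tnth_mktuple.
Qed.

Lemma measurable_tuple_poly (p : mpoly n R) :
  measurable_fun setT (fun x : n.-tuple R => meval (tnth x) p).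
Proof.
apply: measurable_sum => m.
apply: measurable_funM; first exact: measurable_cst.
apply: measurable_prod => i _.
by apply: measurable_funX; exact: measurable_tnth.
Qed.

Lemma diag_measure_integral p :
  (\int[diag_measure nu]_x (meval (tnth x) p)%:E)%E =
  (Re (poly_expect b nu (diag_lift p)))%:E.
Proof.
have gp := bmeas_diag_proj p.
have [[pR _] [B0 pB]] := gp.
have ip : nu.-integrable setT
    (fun Y : T => (meval (tnth (diag_proj Y)) p)%:E).
  by apply: (orbit_bounded_integrable nuP pR); exists B0 => Y /pB[].
rewrite (integral_pushforward measurable_diag_proj
  (mu := nu) (f := EFin \o fun x => meval (tnth x) p)) //; last first.
  by apply/measurable_EFinP; exact: measurable_tuple_poly.
rewrite /poly_expect (@eq_cexpect _ _ b nu _ (fun Y =>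
  ((meval (tnth (diag_proj Y)) p)%:C)%C)) => [|Y]; last exact: eval_diag_lift.
rewrite /= -(Rintegral_orbit nuP pR); last by exists B0 => Y /pB[].
rewrite /Rintegral fineK //.
exact: (integrable_fin_num _ ip).
Qed.

End DiagonalMeasure.

Section Assembly.
Local Open Scope classical_set_scope.
Variables (R : realType) (n : nat).

(** The defining equation of the Schur polynomial has only one solution, since
the Vandermonde polynomial can be cancelled. *)
Lemma schur_tableau (lam : multinom n) : is_partition lam ->
  schur R lam = tableau_schur R lam.
Proof.
move=> Plam; apply: (mulIf (alt_delta_neq0 R n)).
rewrite (tableau_schur_alt R Plam).
have ex : [set s | s * alternant R (delta n) =
    alternant R (mnm_add lam (delta n))] !=set0.
  by exists (tableau_schur R lam); exact: tableau_schur_alt.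
by have := xgetPex 0 ex.
Qed.

Lemma sum_partitions_of_degree (F : multinom n -> R) k :
  (forall lam, F lam != 0 -> mdeg lam = k) ->
  \sum_(lam \in partitions n) F lam =
  \sum_(lam : bmultinom n k.+1 | is_partition lam && (mdeg lam == k)) F lam.
Proof.
move=> Fk.
pose P := [pred lam : bmultinom n k.+1 | is_partition lam && (mdeg lam == k)].
have mP lam : (lam \in [seq bmnm l | l <- enum P]) =
    is_partition lam && (mdeg lam == k).
  apply/mapP/idP => [[l + ->]|Plam]; first by rewrite mem_enum.
  have lk : (mdeg lam < k.+1)%N by case/andP: Plam => _ /eqP ->.
  by exists (BMultinom lk) => //; rewrite mem_enum.
transitivity (\sum_(lam <- [seq bmnm l | l <- enum P]) F lam); last first.
  by rewrite big_map big_enum.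
rewrite [RHS]fsbig_seq.
  apply: esym; apply: fsbig_widen => lam /=.
    by rewrite mP => /andP[/is_partitionP].
  rewrite mP => -[/is_partitionP -> /= kN]; apply/eqP/negPn/negP => /Fk /eqP.
  by [].
by rewrite map_inj_uniq ?enum_uniq //; exact: val_inj.
Qed.

Variables (b : n.-tuple R) (nu : probability (borel_cmx R n) R).
Hypothesis nuP : invariant_orbit_probability b nu.

Lemma diag_monomial_integral (eta : multinom n) :
  complex.Re (poly_expect b nu (diag_lift (mpolyX R eta))) =
    \sum_(lam \in partitions n)
       ((mfact (delta n))%:R * (mfact eta)%:R)
         / (mfact (mnm_add lam (delta n)))%:R
       * (kostka lam eta)%:R * meval (tnth b) (schur R lam).
Proof.
rewrite diag_lift_monomial (diag_moment_complex nuP).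
rewrite (@sum_partitions_of_degree _ (mdeg eta)) => [|lam]; last first.
  move=> nz; apply: kostka_mdeg; apply: contra nz => /eqP ->.
  by rewrite mulr0 mul0r.
set S := (RHS); rewrite -[S]/(complex.Re (S%:C)%C); congr (complex.Re _).
rewrite /S [RHS](rmorph_sum (real_complex R)); apply: eq_bigr => lam /andP[Plam _].
rewrite (schur_tableau Plam) !meval_tableau_schur.
rewrite ![in RHS](rmorphM (real_complex R)) (fmorphV (real_complex R)) /=.
rewrite !(rmorph_nat (real_complex R)); congr (_ * _).
rewrite [RHS](rmorph_sum (real_complex R)); apply: eq_bigr => t _.
by rewrite [RHS](rmorph_prod (real_complex R)).
Qed.

Lemma perms_moment (eta mu : multinom n) : mu \in perms eta ->
  poly_expect b nu (diag_monomial _ mu) = poly_expect b nu (diag_monomial _ eta).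
Proof.
rewrite mem_undup => /mapP[s _ ->].
exact: (diag_moment_sym (fun u F => @poly_expect_conj _ _ _ _ nuP u F)).
Qed.

Lemma diag_msym_integral (eta : multinom n) :
  complex.Re (poly_expect b nu (diag_lift (msympoly R eta))) =
  (size (perms eta))%:R *
  complex.Re (poly_expect b nu (diag_lift (mpolyX R eta))).
Proof.
rewrite /msympoly [diag_lift _]raddf_sum raddf_sum big_seq.
rewrite (eq_bigr (fun=> poly_expect b nu (diag_lift (mpolyX R eta)))).
  rewrite -big_seq big_const_seq count_predT iter_addr_0 mulr_natl.
  exact: ReMn.
by move=> mu /perms_moment; rewrite -2!diag_lift_monomial => h; exact: h.
Qed.

End Assembly.

Local Open Scope classical_set_scope.
Local Open Scope ring_scope.

Theorem theorem3p8 (R : realType) (n : nat) (b : n.-tuple R)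
    (nu_b : probability (borel_cmx R n) R)
    (nu_bP : invariant_orbit_probability b nu_b)
    (eta : multinom n) (eta_partition : partitions n eta) :
  (\int[diag_measure nu_b]_x (meval (tnth x) (msympoly R eta))%:E)%E =
    (\sum_(lam \in partitions n)
       ((mfact (delta n))%:R * (size (perms eta))%:R * (mfact eta)%:R)
         / (mfact (mnm_add lam (delta n)))%:R
       * (kostka lam eta)%:R * meval (tnth b) (schur R lam))%:E
  /\
  (\int[diag_measure nu_b]_x (meval (tnth x) (mpolyX R eta))%:E)%E =
    (\sum_(lam \in partitions n)
       ((mfact (delta n))%:R * (mfact eta)%:R)
         / (mfact (mnm_add lam (delta n)))%:R
       * (kostka lam eta)%:R * meval (tnth b) (schur R lam))%:E.
Proof.
split; rewrite (diag_measure_integral nu_bP); last first.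
  by rewrite (diag_monomial_integral nu_bP).
rewrite (diag_msym_integral nu_bP) (diag_monomial_integral nu_bP); congr EFin.
rewrite mulr_fsumr; apply: eq_fsbigr => lam _.
by rewrite !mulrA [_%:R * (mfact (delta n))%:R]mulrC.
Qed.
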